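(* Let $n\ge 1$ and $\vec a=(a_0,\dots,a_n)\in\mathbb{Z}^{n+1}$. There exist a function $r$ on the positive integers that is periodic with an integer period and an integer $k_0$ such that the tropical Hilbert function satisfies $d_{\vec a}(k)=H_{\vec a}\cdot k+r(k)$ for all $k\ge k_0$, where $H_{\vec a}$ is the tropical entropy of $\vec a$. Moreover, there is an algorithm which, given $\vec a$, computes the function $d_{\vec a}$.
   Context: A sequence $(z_1,\dots,z_k)\in\mathbb{R}^k$ satisfies $\vec a$ if for every $1\le j\le k-n$ the minimum $\min_{0\le i\le n}\{z_{j+i}+a_i\}$ is attained for at least two different values of $i$. $D(k)\subset\mathbb{R}^k$ denotes the set of all such sequences (so $D(k)=\mathbb{R}^k$ for $k\le n$); it is a finite union of polyhedra. The tropical Hilbert function is $d_{\vec a}(k):=\dim D(k)$ (the maximal dimension of a polyhedron in this union). The tropical entropy is $H_{\vec a}:=\lim_{k\to\infty}d_{\vec a}(k)/k$; the limit exists since $d_{\vec a}(k+t)\le d_{\vec a}(k)+d_{\vec a}(t)$. *)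

(* Defs.v *)
From HB Require Import structures.
From mathcomp Require Import all_boot all_order all_algebra.
From mathcomp Require Import all_classical all_reals all_analysis.

Set Implicit Arguments.
Unset Strict Implicit.
Unset Printing Implicit Defensive.

Import Order.TTheory GRing.Theory Num.Theory.
Import numFieldNormedType.Exports.

Local Open Scope classical_set_scope.
Local Open Scope ring_scope.

(* Finitely many non-strict affine inequalities, one per column of [A]. *)
Definition polyhedron (R : realType) (k : nat) (P : set 'rV[R]_k) : Prop :=
  exists (m : nat) (A : 'M[R]_(k, m)) (b : 'rV[R]_m),
    P = [set z | forall i : 'I_m, (z *m A) 0 i <= b 0 i].

Definition affine_subspace (R : realType) (k : nat) (x : 'rV[R]_k)
    (V : {vspace 'rV[R]_k}) : set 'rV[R]_k :=
  [set z | z - x \in V].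

(* [P] is nonempty and its affine hull has dimension [d]. *)
Definition has_affine_dim (R : realType) (k : nat) (P : set 'rV[R]_k)
    (d : nat) : Prop :=
  P !=set0 /\
  exists (x : 'rV[R]_k) (V : {vspace 'rV[R]_k}),
    [/\ \dim V = d,
        P `<=` affine_subspace x V
      & forall (y : 'rV[R]_k) (W : {vspace 'rV[R]_k}),
          P `<=` affine_subspace y W ->
          affine_subspace x V `<=` affine_subspace y W].

(* For a finite union [S] of polyhedra, the maximal dimension of a polyhedron
   of the union; every presentation of [S] as a finite union gives the same
   maximum, so ranging over all of them makes the value depend on [S] only. *)
Definition union_dim (R : realType) (k : nat) (S : set 'rV[R]_k) : nat :=
  (\max_(d < k.+1 | `[< exists (N : nat) (P : 'I_N -> set 'rV[R]_k),
      [/\ forall i, polyhedron (P i),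
          S = \bigcup_i P i
        & exists i, has_affine_dim (P i) d] >]) d)%N.

Lemma window_subproof (k n : nat) (j : 'I_(k - n)) (i : 'I_n.+1) :
  (j + i < k)%N.
Proof.
have jk := ltn_ord j; have i_le : (i <= n)%N by rewrite -ltnS.
by apply: (leq_ltn_trans (leq_add (leqnn j) i_le)); rewrite addnC -ltn_subRL.
Qed.

(* Sequences (z_1, .., z_k) are indexed from 0: the windows start at
   0 <= j < k - n, and there is none when k <= n. *)
Definition window_index (k n : nat) (j : 'I_(k - n)) (i : 'I_n.+1) : 'I_k :=
  Ordinal (window_subproof j i).

Definition min_attained_twice (R : realType) (n : nat) (t : 'I_n.+1 -> R) :
    Prop :=
  exists i1 i2 : 'I_n.+1,
    i1 != i2 /\ forall i : 'I_n.+1, t i1 <= t i /\ t i2 <= t i.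

Definition satisfies (R : realType) (n : nat) (a : n.+1.-tuple int) (k : nat)
    (z : 'rV[R]_k) : Prop :=
  forall j : 'I_(k - n),
    min_attained_twice
      (fun i : 'I_n.+1 => z 0 (window_index j i) + (tnth a i)%:~R).

Definition tropical_solutions (R : realType) (n : nat) (a : n.+1.-tuple int)
    (k : nat) : set 'rV[R]_k :=
  [set z | satisfies a z].

Definition tropical_hilbert (R : realType) (n : nat) (a : n.+1.-tuple int)
    (k : nat) : nat :=
  union_dim (@tropical_solutions R n a k).

Definition tropical_entropy (R : realType) (n : nat) (a : n.+1.-tuple int) :
    R :=
  lim ((fun k : nat => (tropical_hilbert R a k)%:R / k%:R : R) @ \oo).

(* Kleene's partial recursive functions, without fixed arities: a program takes
   a list of arguments, and absent arguments are read as 0. *)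
Inductive recfun : Type :=
  | RZero
  | RSucc
  | RProj of nat
  | RComp of recfun & seq recfun
  | RPrim of recfun & recfun
  | RMin of recfun.

(* [rec_eval f v y]: program [f] halts on arguments [v] with output [y].
   - [RPrim f g] computes h(0, v) = f(v), h(i + 1, v) = g(i, h(i, v), v);
     [s] lists the successive values of h.
   - [RMin f] computes the least y with f(y, v) = 0, provided f(i, v) halts
     for all i < y. *)
Fixpoint rec_eval (f : recfun) (v : seq nat) (y : nat) {struct f} : Prop :=
  match f with
  | RZero => y = 0%N
  | RSucc => y = (nth 0%N v 0).+1
  | RProj i => y = nth 0%N v i
  | RComp f gs =>
      exists2 w : seq nat,
        (fix evals (gs : seq recfun) (w : seq nat) {struct gs} : Prop :=
           match gs, w with
           | [::], [::] => True
           | g :: gs', x :: w' => rec_eval g v x /\ evals gs' w'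
           | _, _ => False
           end) gs w
        & rec_eval f w y
  | RPrim f g =>
      exists s : nat -> nat,
        [/\ rec_eval f (behead v) (s 0%N),
            forall i : nat, (i < nth 0 v 0)%N ->
              rec_eval g [:: i, s i & behead v] (s i.+1)
          & y = s (nth 0%N v 0)]
  | RMin f =>
      rec_eval f (y :: v) 0%N /\
      forall i : nat, (i < y)%N -> exists x : nat, rec_eval f (i :: v) x.+1
  end.

Definition int_code (x : int) : nat :=
  match x with Posz m => m.*2 | Negz m => m.*2.+1 end.

(* [CodeSeq.code] is a bijection from [seq nat] to [nat]. *)
Definition vector_code (n : nat) (a : n.+1.-tuple int) : nat :=
  CodeSeq.code (map int_code a).

(* The function with values [nth 0 ql_table k] for k < size ql_table, extended
   by d (k + ql_period) = d k + ql_incr for k >= size ql_table - ql_period. *)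
Record quasilinear := QuasiLinear {
  ql_period : nat;
  ql_incr : nat;
  ql_table : seq nat;
}.

Definition ql_wf (q : quasilinear) : bool :=
  (0 < ql_period q <= size (ql_table q))%N.

Definition ql_eval (q : quasilinear) (k : nat) : nat :=
  let m := (size (ql_table q) - ql_period q)%N in
  if (k < m)%N then nth 0%N (ql_table q) k
  else (nth 0 (ql_table q) (m + (k - m) %% ql_period q)
        + ql_incr q * ((k - m) %/ ql_period q))%N.

Definition ql_code (q : quasilinear) : nat :=
  CodeSeq.code [:: ql_period q, ql_incr q & ql_table q].

(* An infinite function is output as a finite description from which all its
   values on positive integers are read off. *)
Definition computes_tropical_hilbert (R : realType) (e : recfun) : Prop :=
  forall (n : nat) (a : n.+1.-tuple int), (1 <= n)%N ->
    exists q : quasilinear,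
      [/\ ql_wf q,
          rec_eval e [:: vector_code a] (ql_code q)
        & forall k : nat, (0 < k)%N -> tropical_hilbert R a k = ql_eval q k].

(* Main.v *)
(* Call an entry z_t of a solution fresh if it is congruent modulo 1 to none of
   the n preceding entries. Entries tied in a window are congruent modulo 1, so
   fresh entries lie in distinct classes of ties and can be moved independently;
   conversely, at a point of a cell with the fewest ties, separating the classes
   of ties modulo 1 makes their first entries fresh. Hence d(k) is the largest
   number of fresh entries of a solution of length k.
   The minima of consecutive windows differ by a bounded amount, and an entry
   attaining no minimum can be moved by integers, so the differences inside
   windows may be assumed bounded. Recording the floors of these differences
   makes solutions the walks of a finite graph: whether a new entry can be added
   with prescribed floors depends only on the floors already present. Then d(k)
   is the maximal weight of a walk of given length. With S vertices, S! is a
   common multiple of the lengths of all simple cycles, and a pigeonhole argument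
   on cycles gives d(k + S!) = d(k) + c past an explicit bound.
   Finally, ranking fractional parts turns a bounded solution of length k into
   one with bounded entries in (1/k)Z, so that d(k) is found by a finite search. *)

Require Import Defs.
From HB Require Import structures.
From mathcomp Require Import all_boot all_order all_algebra.
From mathcomp Require Import all_classical all_reals all_analysis.
From mathcomp Require Import zify lra.

Set Implicit Arguments.
Unset Strict Implicit.
Unset Printing Implicit Defensive.

Import Order.TTheory GRing.Theory Num.Theory.
Import numFieldNormedType.Exports.

(** * Maximal weights of long walks in a finite directed graph *)

Definition walk_weight (V : Type) (w : V -> nat) (s : seq V) : nat :=
  \sum_(y <- s) w y.

(** The second factor counts disjoint blocks of length [S]. With p = S!, removing a whole period
    takes p S of them, and forcing a critical cycle takes 2 p S + p b + 1. *)
Definition max_walk_preperiod (S b : nat) : nat :=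
  S * (3 * S`! * S + S`! * b + 1).

Lemma walk_weight_cat (V : Type) (w : V -> nat) (s t : seq V) :
  walk_weight w (s ++ t) = walk_weight w s + walk_weight w t.
Proof. exact: big_cat. Qed.

Lemma last_take (V : Type) (x : V) (s : seq V) (i : nat) :
  i <= size s -> last x (take i s) = nth x (x :: s) i.
Proof.
by move=> ile; rewrite (last_nth x) size_takel // -[x :: _]/(take i.+1 (x :: s)) nth_take.
Qed.

Section MaxWalk.
Variables (V : finType) (E : rel V) (w : V -> nat).
Hypothesis w_le1 : forall v, w v <= 1.

Local Notation S := #|V|.
Local Notation p := (S`!).
Local Notation W := (walk_weight w).

Lemma walk_weight_le_size (s : seq V) : W s <= size s.
Proof. by rewrite -sum1_size; apply: leq_sum. Qed.

Definition short_cycle (x : V) (s : seq V) : bool :=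
  [&& path E x s, last x s == x, 0 < size s & size s <= S].

(** Pigeonhole on the first S + 1 vertices. The cycle ends within [S] steps, so the argument can be
    repeated on the remaining walk [s3]. *)
Lemma short_cycle_in_walk (x : V) (s : seq V) : path E x s -> S <= size s ->
  exists s1 s2 s3, [/\ s = s1 ++ s2 ++ s3, size (s1 ++ s2) <= S
    & short_cycle (last x s1) s2].
Proof.
move=> xs Ss.
have : ~~ uniq (x :: take S s).
  apply/negP => /card_uniqP e; have := max_card (mem (x :: take S s)).
  by rewrite e /= size_takel // ltnn.
case/(uniqPn x) => i [j [ij jS]].
have e0 : size (x :: take S s) = S.+1 by rewrite /= size_takel.
rewrite e0 ltnS in jS.
rewrite -[x :: _]/(take S.+1 (x :: s)) !nth_take //.
2: lia.
have js' : j <= size s := leq_trans jS Ss.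
have is' : i <= size s := ltnW (leq_trans ij js').
rewrite -!last_take // => e.
have s_cat : s = take i s ++ drop i (take j s) ++ drop j s.
  have -> : take i s = take i (take j s) by rewrite take_takel // ltnW.
  by rewrite catA !cat_take_drop.
have js : size (take j s) = j by rewrite size_takel.
have tj : take i s ++ drop i (take j s) = take j s.
  have -> : take i s = take i (take j s) by rewrite take_takel // ltnW.
  by rewrite cat_take_drop.
exists (take i s), (drop i (take j s)), (drop j s); split => //.
  by rewrite tj js.
apply/and4P; split.
- by move: xs; rewrite {1}s_cat !cat_path => /and3P[].
- by rewrite -last_cat tj e.
- by rewrite size_drop js; lia.
- by rewrite size_drop js; lia.
Qed.

Variable c : nat.
Hypothesis c_max : forall x s, short_cycle x s -> p * W s <= c * size s.

(* Cycles are cut out of disjoint consecutive blocks of length [S], so that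
   any subfamily of them can be removed. *)
Lemma remove_cycles (N : nat) (x : V) (s : seq V) :
  path E x s -> N * S <= size s ->
  exists g : nat -> nat, N <= \sum_(l < S) g l.+1 /\
    forall l q, q <= g l -> exists s', [/\ path E x s',
      size s' + q * l = size s & p * W s <= p * W s' + c * (q * l)].
Proof.
elim: N x s => [|N IH] x s xs Ns.
  exists (fun=> 0); split => // l q; rewrite leqn0 => /eqP ->.
  by exists s; split => //; rewrite ?mul0n ?muln0 ?addn0.
have [|s1 [s2 [s3 [es s12 cyc]]]] := short_cycle_in_walk xs; first by lia.
have [p2 /eqP l2 n2 S2] := and4P cyc.
move: (xs); rewrite {1}es !cat_path l2 => /and3P[p1 _ p3].
have [|g [gN gP]] := IH _ _ p3.
  by move: Ns; rewrite mulSn es catA size_cat; lia.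
(* [g l] counts the cycles of length [l] found so far; the newest one is the first to be removed. *)
exists (fun l => g l + (l == size s2)); split.
  rewrite big_split /= -addn1 leq_add //.
  have k2 : (size s2).-1 < S by lia.
  by rewrite (bigD1 (Ordinal k2)) //= prednK // eqxx.
have keep l q : q <= g l -> exists s', [/\ path E x s',
    size s' + q * l = size s & p * W s <= p * W s' + c * (q * l)].
  move=> /gP[s' [ps' sz wt]]; exists (s1 ++ s2 ++ s'); split.
  - by rewrite !cat_path l2 p1 p2.
  - by rewrite es !size_cat -sz; lia.
  - by rewrite es !walk_weight_cat !mulnDr; lia.
move=> l [|q] qg; first by apply: keep.
have [el|nl] := eqVneq l (size s2); last first.
  by apply: keep; move: qg; rewrite (negbTE nl) addn0.
have [|s' [ps' sz wt]] := gP l q.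
  by move: qg; rewrite el eqxx addn1.
exists (s1 ++ s'); split.
- by rewrite cat_path p1.
- by rewrite es !size_cat -sz el; lia.
- have := c_max cyc; rewrite es !walk_weight_cat -el mulSn !mulnDr; lia.
Qed.

(** Among S p disjoint cycles with at most [S] different lengths, some length l occurs [p] times. As
    l divides [p], cutting out p / l of these shortens the walk by exactly [p], at a cost of at most
    [c]. *)
Lemma remove_period (x : V) (s : seq V) : path E x s -> S * p * S <= size s ->
  exists s', [/\ path E x s', size s' + p = size s & W s <= W s' + c].
Proof.
move=> xs Ss; have [g [gN gP]] := remove_cycles xs Ss.
have p0 : 0 < p := fact_gt0 _.
have S0 : 0 < S by apply/card_gt0P; exists x.
have [l gl] : exists l : 'I_S, p <= g l.+1.
  apply/existsP; rewrite -[X in is_true X]negbK negb_exists; apply/negP => /forallP h.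
  have : \sum_(l < S) g l.+1 <= \sum_(l < S) p.-1.
    by apply: leq_sum => l _; have := h l; lia.
  by rewrite sum_nat_const card_ord; nia.
have ldvd : l.+1 %| p by rewrite dvdn_fact //; apply: ltn_ord.
have [|s' [ps' sz wt]] := gP l.+1 (p %/ l.+1).
  by apply: leq_trans gl; apply: leq_div.
rewrite divnK // in sz wt.
by exists s'; split => //; rewrite -(leq_pmul2l p0) mulnDr [p * c]mulnC.
Qed.

(** Cutting out short cycles, whose mean weight is at most c / p, leaves fewer than [S] steps of
    weight at most 1. *)
Lemma walk_weight_le_mean (x : V) (s : seq V) : path E x s ->
  p * W s <= c * size s + p * S.
Proof.
have [m] := ubnP (size s); elim: m x s => // m IH x s sm xs.
have [Ss|sS] := leqP S (size s); last first.
  have : W s <= S by apply: leq_trans (walk_weight_le_size s) _; lia.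
  by move=> /(leq_mul (leqnn p)); lia.
have [s1 [s2 [s3 [es s12 cyc]]]] := short_cycle_in_walk xs Ss.
have [p2 /eqP l2 n2 S2] := and4P cyc.
move: (xs); rewrite {1}es !cat_path l2 => /and3P[p1 _ p3].
have /IH : size (s1 ++ s3) < m by move: sm; rewrite es !size_cat; lia.
move=> /(_ x); rewrite cat_path p1 => /(_ p3).
have := c_max cyc; rewrite es !walk_weight_cat !size_cat !mulnDr; lia.
Qed.

(** By integrality, each of [N] noncritical cycles cut out lowers the deficit [c * size s - p * W s]
    by at least 1. *)
Lemma noncritical_loss (N : nat) (x : V) (s : seq V) :
  path E x s -> N * S <= size s ->
  (forall s1 s2 s3, s = s1 ++ s2 ++ s3 -> short_cycle (last x s1) s2 ->
     p * W s2 < c * size s2) ->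
  exists s', [/\ path E x s', size s' <= size s
    & p * W s + N + c * size s' <= p * W s' + c * size s].
Proof.
elim: N x s => [|N IH] x s xs Ns nc; first by exists s; split => //; rewrite addn0.
have [|s1 [s2 [s3 [es s12 cyc]]]] := short_cycle_in_walk xs; first by lia.
have [p2 /eqP l2 n2 S2] := and4P cyc.
move: (xs); rewrite {1}es !cat_path l2 => /and3P[p1 _ p3].
have [||s' [ps' sz wt]] := IH _ _ p3.
- by move: Ns; rewrite mulSn es catA size_cat; lia.
- move=> t1 t2 t3 et cyct; apply: (nc (s1 ++ s2 ++ t1) t2 t3).
    by rewrite es et !catA.
  by rewrite !last_cat l2.
exists (s1 ++ s'); split.
- by rewrite cat_path p1.
- by rewrite es !size_cat; lia.
- by have := nc _ _ _ es cyc; rewrite es !walk_weight_cat !size_cat !mulnDr; lia.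
Qed.

Lemma iter_cycle (q : nat) (x : V) (s t : seq V) :
  path E x s -> last x s = x -> path E x t -> path E x (iter q (cat s) t).
Proof. by move=> xs ls xt; elim: q => //= q IH; rewrite cat_path xs ls. Qed.

Lemma walk_weight_iter (q : nat) (s t : seq V) :
  W (iter q (cat s) t) = q * W s + W t.
Proof. by elim: q => [|q IH] /=; rewrite ?add0n // walk_weight_cat IH mulSn addnA. Qed.

Lemma size_iter_cat (q : nat) (s t : seq V) :
  size (iter q (cat s) t) = q * size s + size t.
Proof. by elim: q => [|q IH] /=; rewrite ?add0n // size_cat IH mulSn addnA. Qed.

Variables (x0 : V) (s0 : seq V).
Hypotheses (cyc0 : short_cycle x0 s0) (crit0 : p * W s0 = c * size s0).

(** The walk turns around the critical cycle and is truncated after [m] steps; the part cut off is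
    at most one turn. *)
Lemma critical_walk (m : nat) :
  exists s, [/\ path E x0 s, size s = m & c * m <= p * W s + p * S].
Proof.
have [p0 /eqP l0 n0 S0] := and4P cyc0.
set q := (m %/ size s0).+1; set t := iter q (cat s0) [::].
have st : size t = q * size s0 by rewrite size_iter_cat addn0.
have mt : m < size t by rewrite st; apply: ltn_ceil.
have mt2 : q * size s0 <= m + size s0 by rewrite mulSn addnC leq_add2r leq_divM.
exists (take m t); split.
- have := iter_cycle q p0 l0 (isT : path E x0 [::]).
  by rewrite -/t -{1}(cat_take_drop m t) cat_path => /andP[].
- by rewrite size_takel // ltnW.
- have : W t = q * W s0 by rewrite walk_weight_iter /walk_weight big_nil addn0.
  have dm : W (drop m t) <= S.
    by apply: leq_trans (walk_weight_le_size _) _; rewrite size_drop st; lia.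
  rewrite -{1}(cat_take_drop m t) walk_weight_cat => eW.
  have : c * m <= p * (q * W s0).
    by rewrite mulnCA crit0 mulnCA -st leq_mul2l (ltnW mt) orbT.
  rewrite -eW mulnDr; have := leq_mul (leqnn p) dm; lia.
Qed.

Variables (w0 : V -> nat) (b : nat) (f : nat -> nat).
Hypothesis w0_le : forall v, w0 v <= b.
Hypothesis f_ub : forall x s, path E x s -> w0 x + W s <= f (size s).
Hypothesis f_att : forall m, exists x s,
  [/\ path E x s, size s = m & f m = w0 x + W s].

(** Removing a period from an optimal walk gives one inequality; repeating a critical cycle inside
    an optimal walk gives the other. *)
Lemma max_walk_step (m : nat) : max_walk_preperiod S b <= m ->
  f (m + p) = f m + c.
Proof.
rewrite /max_walk_preperiod => mS; apply/eqP; rewrite eqn_leq; apply/andP; split.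
  have [x [s [xs sz ->]]] := f_att (m + p).
  have [|s' [xs' sz' wt]] := remove_period xs.
    by rewrite sz; nia.
  have := f_ub xs'; have -> : size s' = m by lia.
  lia.
have [x [s [xs sz fm]]] := f_att m; rewrite fm.
suff [s1 [s2 [s3 [es cyc crit]]]] : exists s1 s2 s3,
    [/\ s = s1 ++ s2 ++ s3, short_cycle (last x s1) s2 & c * size s2 <= p * W s2].
  have [p2 /eqP l2 n2 S2] := and4P cyc.
  have dvd2 : size s2 %| p by rewrite dvdn_fact // n2.
  have e2 : p * W s2 = c * size s2 by apply/eqP; rewrite eqn_leq (c_max cyc).
  move: (xs); rewrite {1}es !cat_path l2 => /and3P[p1 _ p3].
  have := @f_ub x (s1 ++ iter (p %/ size s2) (cat s2) (s2 ++ s3)).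
  rewrite cat_path p1 iter_cycle //; last by rewrite cat_path p2 l2.
  move=> /(_ isT); rewrite size_cat size_iter_cat divnK // !walk_weight_cat.
  rewrite walk_weight_iter walk_weight_cat.
  have -> : p %/ size s2 * W s2 = c.
    apply/eqP; rewrite -(eqn_pmul2r n2) mulnAC divnK // e2 //.
  have <- : size s1 + (p + size (s2 ++ s3)) = m + p by rewrite -sz es !size_cat; lia.
  rewrite es !walk_weight_cat; lia.
(* Without a critical cycle, the optimal walk would fall behind the walk around [s0]: the loss 2 p S
   + p b + 1 exceeds the two errors p S and the contribution p b of the initial weight. *)
apply: contrapT => nc.
have [||s' [xs' sz' wt]] := @noncritical_loss (2 * p * S + p * b + 1) x s xs.
- by rewrite sz; nia.
- move=> s1 s2 s3 es cyc; rewrite ltnNge; apply/negP => h; apply: nc.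
  by exists s1, s2, s3.
have wm := walk_weight_le_mean xs'.
have [t [pt tm tw]] := critical_walk m.
have := f_ub pt; rewrite tm fm => ft.
have : W t <= b + W s by have := w0_le x; lia.
move=> /(leq_mul (leqnn p)); rewrite mulnDr; lia.
Qed.
End MaxWalk.

Theorem max_walk_quasilinear (V : finType) (E : rel V) (w w0 : V -> nat)
    (b : nat) (f : nat -> nat) :
  (forall v, w v <= 1) -> (forall v, w0 v <= b) ->
  (forall x s, path E x s -> w0 x + walk_weight w s <= f (size s)) ->
  (forall m, exists x s,
     [/\ path E x s, size s = m & f m = w0 x + walk_weight w s]) ->
  exists c, forall m, max_walk_preperiod #|V| b <= m ->
    f (m + (#|V|)`!) = f m + c.
Proof.
move=> w_le1 w0_le f_ub f_att; set p := (#|V|)`!.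
(* [Q] holds of [p] times the mean weights of short cycles. These are integers, since the length of
   a short cycle divides [p]; the largest one is the increment. *)
pose Q c := `[< exists x s, short_cycle E x s /\
  p * walk_weight w s = c * size s >].
have Q_of x s : short_cycle E x s -> Q (p %/ size s * walk_weight w s).
  move=> cyc; have [_ _ n2 S2] := and4P cyc.
  by apply/asboolP; exists x, s; split; rewrite // mulnAC divnK // dvdn_fact // n2.
have exQ : exists c, Q c.
  have [x [s [xs sz _]]] := f_att #|V|.
  have [|s1 [s2 [s3 [_ _ cyc]]]] := short_cycle_in_walk xs; first by rewrite sz.
  by eexists; apply: Q_of cyc.
have ubQ c : Q c -> c <= p.
  move=> /asboolP[x [s [/and4P[_ _ n2 S2] e]]].
  by rewrite -(leq_pmul2r n2) -e leq_mul2l walk_weight_le_size ?orbT.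
case: (ex_maxnP exQ ubQ) => c /asboolP[x0 [s0 [cyc0 crit0]]] c_max.
exists c => m mS.
apply: (max_walk_step w_le1 _ cyc0 crit0 w0_le f_ub f_att mS) => x s cyc.
have [_ _ n2 S2] := and4P cyc.
have := c_max _ (Q_of _ _ cyc); rewrite -(leq_pmul2r n2) mulnAC divnK //.
by rewrite dvdn_fact // n2.
Qed.

(** * Closure properties of total recursive functions *)

Definition computable (m : nat) (F : seq nat -> nat) : Prop :=
  exists e : recfun, forall v, size v = m -> rec_eval e v (F v).

Lemma computable_ext m F G : (forall v, size v = m -> F v = G v) ->
  computable m F -> computable m G.
Proof. by move=> FG [e eF]; exists e => v vm; rewrite -FG //; apply: eF. Qed.

Lemma computable_nth m i : computable m (fun v => nth 0 v i).
Proof. by exists (RProj i). Qed.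

(** The index list [I] lets one statement cover every arity, and also the reordering or dropping of
    variables. *)
Lemma computable_comp m (I : seq nat) (G : nat -> seq nat -> nat) F :
  (forall i, i \in I -> computable m (G i)) -> computable (size I) F ->
  computable m (fun v => F [seq G i v | i <- I]).
Proof.
move=> cG [f fF].
suff [gs gsP] : exists gs, forall v, size v = m ->
   (fix evals (gs : seq recfun) (w : seq nat) {struct gs} : Prop :=
           match gs, w with
           | [::], [::] => True
           | g :: gs', x :: w' => rec_eval g v x /\ evals gs' w'
           | _, _ => False
           end) gs [seq G i v | i <- I].
  exists (RComp f gs) => v vm /=; exists [seq G i v | i <- I]; first exact: gsP.
  by apply: fF; rewrite size_map.
elim: I cG {f fF} => [|i I IH] cG; first by exists [::].
have [|gs gsP] := IH; first by move=> j jI; apply: cG; rewrite inE jI orbT.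
have [g gP] := cG i (mem_head _ _).
by exists (g :: gs) => v vm; split; [apply: gP | apply: gsP].
Qed.

(** Weakening: bound variables are kept at the front of the argument list, so an expression of the
    outer context reads its tail. *)
Lemma computable_behead m F : computable m F ->
  computable m.+1 (fun v => F (behead v)).
Proof.
move=> cF; have : computable (size (iota 0 m)) F by rewrite size_iota.
move/(computable_comp (fun i _ => computable_nth m.+1 i.+1)).
apply: computable_ext => -[|x v] //= [<-]; congr F.
by rewrite -[RHS](mkseq_nth 0).
Qed.

Lemma computable_cons m F G : computable m F -> computable m.+1 G ->
  computable m (fun v => G (F v :: v)).
Proof.
move=> cF; rewrite -[m.+1](size_iota 0) => cG.
pose H i v := if i is j.+1 then nth 0 v j else F v.
have : computable m (fun v => G [seq H i v | i <- iota 0 m.+1]).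
  by apply: computable_comp cG => -[|i] _ //; apply: computable_nth.
apply: computable_ext => v <-; congr (G (_ :: _)).
rewrite -[LHS]/[seq H i v | i <- iota (1 + 0) (size v)] iotaDl -map_comp.
by rewrite -[RHS](mkseq_nth 0).
Qed.

Lemma computable_rec m N F G :
  computable m N -> computable m F ->
  computable m.+2 (fun v => G (nth 0 v 0) (nth 0 v 1) (behead (behead v))) ->
  computable m (fun v => nat_rec _ (F v) (fun i h => G i h v) (N v)).
Proof.
move=> cN [f fF] [g gG].
apply: (computable_ext _ (computable_cons (G := fun v =>
  nat_rec _ (F (behead v)) (fun i h => G i h (behead v)) (nth 0 v 0)) cN _)) => //.
exists (RPrim f g) => -[|x v] //= [vm].
exists (nat_rec _ (F v) (fun i h => G i h v)); split => //; first exact: fF.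
by move=> i _; apply: (gG [:: i, _ & v]); rewrite /= vm.
Qed.

Lemma computable_succ m F : computable m F -> computable m (fun v => (F v).+1).
Proof.
move=> cF; have : computable 1 (fun v => (nth 0 v 0).+1) by exists RSucc.
rewrite -[1]/(size [:: 0]).
by move/(computable_comp (G := fun _ => F)); apply => i.
Qed.

Lemma computable_const m c : computable m (fun=> c).
Proof.
by elim: c => [|c IH]; [exists RZero | apply: computable_succ].
Qed.

Lemma computable_pred m F : computable m F -> computable m (fun v => (F v).-1).
Proof.
move=> cF; apply: (computable_ext _ (computable_rec (G := fun i _ _ => i) cF
  (computable_const m 0) (computable_nth _ 0))) => v _.
by case: (F v).
Qed.

Lemma computable_add m F G : computable m F -> computable m G ->
  computable m (fun v => F v + G v).
Proof.
move=> cF cG; apply: (computable_ext _ (computable_rec (G := fun _ h _ => h.+1)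
  cF cG (computable_succ (computable_nth _ 1)))) => v _.
by elim: (F v) => //= x ->.
Qed.

Lemma computable_sub m F G : computable m F -> computable m G ->
  computable m (fun v => F v - G v).
Proof.
move=> cF cG; apply: (computable_ext _ (computable_rec (G := fun _ h _ => h.-1)
  cG cF (computable_pred (computable_nth _ 1)))) => v _.
by elim: (G v) => [|x /= ->]; rewrite ?subn0 // subnS.
Qed.

Lemma computable_leq m F G : computable m F -> computable m G ->
  computable m (fun v => F v <= G v).
Proof.
move=> cF cG; apply: (computable_ext _ (computable_sub (computable_const m 1)
  (computable_sub cF cG))) => v _.
by rewrite /leq; case: (F v - G v).
Qed.

Lemma computable_big (idx : nat) (op : Monoid.law idx) m N F :
  (forall m' A B, computable m' A -> computable m' B ->
     computable m' (fun v => op (A v) (B v))) ->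
  computable m N ->
  computable m.+1 (fun v => F (nth 0 v 0) (behead v)) ->
  computable m (fun v => \big[op/idx]_(0 <= i < N v) F i v).
Proof.
move=> c_op cN cF.
apply: (computable_ext _ (computable_rec (G := fun i h v => op h (F i v))
  cN (computable_const m idx) _)) => [v _|].
  by elim: (N v) => [|x IH]; [rewrite big_geq | rewrite big_nat_recr //= IH].
apply: c_op; first exact: computable_nth.
(* Position 1, which holds the accumulated value of the recursion, is skipped. *)
have : computable (size (0 :: iota 2 m)) (fun v => F (nth 0 v 0) (behead v)).
  by rewrite /= size_iota.
move/(computable_comp (fun i _ => computable_nth m.+2 i)).
apply: computable_ext => -[|x [|y v]] //= [<-]; congr F.
by rewrite -[2]addn0 iotaDl -map_comp -[RHS](mkseq_nth 0).
Qed.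

Lemma computable_sum m N F : computable m N ->
  computable m.+1 (fun v => F (nth 0 v 0) (behead v)) ->
  computable m (fun v => \sum_(0 <= i < N v) F i v).
Proof. exact: computable_big computable_add. Qed.

Lemma computable_mul m F G : computable m F -> computable m G ->
  computable m (fun v => F v * G v).
Proof.
move=> cF cG; apply: (computable_ext _ (computable_sum (F := fun _ v => F v)
  cG (computable_behead cF))) => v _.
by rewrite sum_nat_const_nat subn0 mulnC.
Qed.

Lemma computable_prod m N F : computable m N ->
  computable m.+1 (fun v => F (nth 0 v 0) (behead v)) ->
  computable m (fun v => \prod_(0 <= i < N v) F i v).
Proof. exact: computable_big computable_mul. Qed.

Lemma computable_max m N F : computable m N ->
  computable m.+1 (fun v => F (nth 0 v 0) (behead v)) ->
  computable m (fun v => \max_(0 <= i < N v) F i v).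
Proof.
apply: computable_big => m' A B cA cB.
apply: (computable_ext _ (computable_add cA (computable_sub cB cA))) => v _.
by rewrite /= maxnE.
Qed.

Lemma computable_exp m F G : computable m F -> computable m G ->
  computable m (fun v => F v ^ G v).
Proof.
move=> cF cG; apply: (computable_ext _ (computable_prod (F := fun _ v => F v)
  cG (computable_behead cF))) => v _.
by rewrite prod_nat_const_nat subn0.
Qed.

Lemma computable_fact m F : computable m F -> computable m (fun v => (F v)`!).
Proof.
move=> cF; apply: (computable_ext _ (computable_prod (F := fun i _ => i.+1)
  cF (computable_succ (computable_nth _ 0)))) => v _.
by rewrite fact_prod big_add1.
Qed.

Lemma computable_negb m (P : seq nat -> bool) :
  computable m P -> computable m (fun v => ~~ P v).
Proof.
move=> cP; apply: (computable_ext _ (computable_sub (computable_const m 1) cP)).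
by move=> v _; case: (P v).
Qed.

Lemma computable_andb m (P Q : seq nat -> bool) :
  computable m P -> computable m Q -> computable m (fun v => P v && Q v).
Proof.
move=> cP cQ; apply: (computable_ext _ (computable_mul cP cQ)) => v _.
by rewrite mulnb.
Qed.

Lemma computable_eqn m F G : computable m F -> computable m G ->
  computable m (fun v => F v == G v).
Proof.
move=> cF cG; apply: (computable_ext _ (computable_andb (computable_leq cF cG)
  (computable_leq cG cF))) => v _.
by rewrite eqn_leq.
Qed.

Lemma computable_all m N (P : nat -> seq nat -> bool) : computable m N ->
  computable m.+1 (fun v => P (nth 0 v 0) (behead v)) ->
  computable m (fun v => all (P^~ v) (iota 0 (N v))).
Proof.
move=> cN cP; apply: (computable_ext _ (computable_prod (F := fun i v => P i v)
  cN cP)) => v _.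
rewrite /index_iota subn0; elim: (iota 0 (N v)) => [|i s IH]; first by rewrite big_nil.
by rewrite big_cons IH mulnb.
Qed.

Lemma computable_has m N (P : nat -> seq nat -> bool) : computable m N ->
  computable m.+1 (fun v => P (nth 0 v 0) (behead v)) ->
  computable m (fun v => has (P^~ v) (iota 0 (N v))).
Proof.
move=> cN cP; apply: (computable_ext _ (computable_negb
  (computable_all (P := fun i v => ~~ P i v) cN (computable_negb cP)))) => v _.
by rewrite -has_predC; congr (nat_of_bool _); apply: eq_has => i /=; rewrite negbK.
Qed.

Lemma computable_count m N (P : nat -> seq nat -> bool) : computable m N ->
  computable m.+1 (fun v => P (nth 0 v 0) (behead v)) ->
  computable m (fun v => count (P^~ v) (iota 0 (N v))).
Proof.
move=> cN cP; apply: (computable_ext _ (computable_sum (F := fun i v => P i v)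
  cN cP)) => v _.
by rewrite /index_iota subn0 -sumn_count sumnE big_map.
Qed.

Lemma count_ltn_iota q N : q <= N -> count (fun i => i < q) (iota 0 N) = q.
Proof.
move=> qN; rewrite -(subnKC qN) iotaD count_cat.
have -> : count (fun i => i < q) (iota 0 q) = q.
  rewrite (eq_in_count (a2 := predT)) ?count_predT ?size_iota // => i.
  by rewrite mem_iota.
rewrite (eq_in_count (a2 := pred0)) ?count_pred0 ?addn0 // => i.
by rewrite mem_iota add0n => /andP[qi _]; rewrite ltnNge qi.
Qed.

(** The quotient is the number of [i < F v] with [i.+1 * G v <= F v]; the factor [1 <= G v] accounts
    for division by 0 being 0. *)
Lemma computable_div m F G : computable m F -> computable m G ->
  computable m (fun v => F v %/ G v).
Proof.
move=> cF cG.
apply: (computable_ext _ (computable_mul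
  (computable_leq (computable_const m 1) cG)
  (computable_count (P := fun i v => i.+1 * G v <= F v) cF
     (computable_leq (computable_mul (computable_succ (computable_nth _ 0))
        (computable_behead cG)) (computable_behead cF))))) => v _.
case: (posnP (G v)) => [->|g0]; first by rewrite divn0.
rewrite mul1n (eq_count (a2 := fun i => i < F v %/ G v)); last first.
  by move=> i; rewrite /= leq_divRL.
by rewrite count_ltn_iota // leq_div.
Qed.

Lemma computable_mod m F G : computable m F -> computable m G ->
  computable m (fun v => F v %% G v).
Proof.
move=> cF cG; apply: (computable_ext _ (computable_sub cF
  (computable_mul (computable_div cF cG) cG))) => v _.
by rewrite {1}(divn_eq (F v) (G v)) addKn.
Qed.

Lemma computable_iter m N F g : computable m N -> computable m F ->
  (forall m' A, computable m' A -> computable m' (fun v => g (A v))) ->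
  computable m (fun v => iter (N v) g (F v)).
Proof.
move=> cN cF cg; apply: (computable_ext _ (computable_rec (G := fun _ h _ => g h)
  cN cF (cg _ _ (computable_nth _ 1)))) => v _.
by elim: (N v) => //= x ->.
Qed.

(** * The program *)

(** The code of [h :: t] is 2^h times an odd number, so its head is a 2-adic valuation. *)
Definition code_head (x : nat) : nat :=
  count (fun i => x %% 2 ^ i.+1 == 0) (iota 0 x).

Definition code_tail (x : nat) : nat := x %/ 2 ^ (code_head x).+1.

Definition code_nth (c i : nat) : nat := code_head (iter i code_tail c).

Definition code_size (c : nat) : nat :=
  count (fun i => 0 < iter i code_tail c) (iota 0 c).

(* A code exceeds the entries that it encodes, so the shift by [c] makes all
   coefficients nonnegative. *)
Definition shifted_coef (c i : nat) : nat :=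
  c + (1 - code_nth c i %% 2) * (code_nth c i %/ 2)
  - (code_nth c i %% 2) * (code_nth c i %/ 2).+1.

(** After normalization, an entry is within 2 A n + A + 2 of the minimum of a window containing it,
    and two such minima differ by at most 2 A n. *)
Definition spread (A n : nat) : nat := 6 * A * n + 2 * A + 4.

Definition region_count (A n : nat) : nat :=
  (2 * spread A n).+1 ^ (n.+1 * n.+1).

Definition hilbert_period (A n : nat) : nat := (region_count A n)`!.

(** A walk of m steps describes a solution of length n + 1 + m, whose first window contributes at
    most n + 1 fresh entries. *)
Definition hilbert_preperiod (A n : nat) : nat :=
  n.+1 + max_walk_preperiod (region_count A n) n.+1.

Definition tropical_solb (n k : nat) (al y : nat -> nat) : bool :=
  all (fun j => has (fun i1 => has (fun i2 => (~~ (i1 == i2)) &&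
    all (fun i => (y (j + i1) + al i1 <= y (j + i) + al i) &&
                  (y (j + i2) + al i2 <= y (j + i) + al i))
      (iota 0 n.+1)) (iota 0 n.+1)) (iota 0 n.+1)) (iota 0 (k - n)).

(** [y] stands for the sequence y / k, so congruence modulo 1 becomes congruence modulo [k]. *)
Definition fresh_residues (n k : nat) (y : nat -> nat) : nat :=
  count (fun t => all (fun s => ~~ ((t <= s + n) && (y t %% k == y s %% k)))
    (iota 0 t)) (iota 0 k).

Definition digit (Y x t : nat) : nat := (x %/ Y ^ t) %% Y.

(** The entries searched have the form k h + r with [h <= 2 * k * spread A n] and [r < k]. *)
Definition digit_bound (A n k : nat) : nat := k * (2 * k * spread A n + 2).

(** The digits of [x] run through all sequences of length [k] with bounded entries; the Boolean
    factor discards those that are not solutions. *)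
Definition hilbert_search (c n k : nat) : nat :=
  \max_(0 <= x < digit_bound c n k ^ k)
    (tropical_solb n k (fun i => k * shifted_coef c i) (digit (digit_bound c n k) x)
     * fresh_residues n k (digit (digit_bound c n k) x)).

(** A list code is built from its last entry backwards, hence the index [N - i.+1]. *)
Definition hilbert_table_code (c n N : nat) : nat :=
  nat_rec _ 0 (fun i h => 2 ^ hilbert_search c n (N - i.+1) * (h + h).+1) N.

Definition hilbert_output (c n M P : nat) : nat :=
  2 ^ P * (2 * (2 ^ (hilbert_search c n (M + P) - hilbert_search c n M)
    * (2 * hilbert_table_code c n (M + P)).+1)).+1.

(** The code [c] doubles as a bound on the absolute values of the coefficients. *)
Definition hilbert_program (c : nat) : nat :=
  hilbert_output c (code_size c).-1 (hilbert_preperiod c (code_size c).-1)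
    (hilbert_period c (code_size c).-1).

(** * Computability of the program *)

Lemma computable_subst1 f m A : computable 1 (fun v => f (nth 0 v 0)) ->
  computable m A -> computable m (fun v => f (A v)).
Proof.
by rewrite -[1]/(size [:: 0]) => /(computable_comp (G := fun=> A)) + cA; apply=> i.
Qed.

Lemma computable_subst2 f m A B :
  computable 2 (fun v => f (nth 0 v 0) (nth 0 v 1)) ->
  computable m A -> computable m B -> computable m (fun v => f (A v) (B v)).
Proof.
rewrite -[2]/(size [:: 0; 1]).
move=> /(computable_comp (G := fun i v => nth 0 [:: A v; B v] i)) + cA cB.
by apply=> -[|[|i]].
Qed.

Lemma computable_subst3 f m A B C :
  computable 3 (fun v => f (nth 0 v 0) (nth 0 v 1) (nth 0 v 2)) ->
  computable m A -> computable m B -> computable m C ->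
  computable m (fun v => f (A v) (B v) (C v)).
Proof.
rewrite -[3]/(size [:: 0; 1; 2]).
move=> /(computable_comp (G := fun i v => nth 0 [:: A v; B v; C v] i)) + cA cB cC.
by apply=> -[|[|[|i]]].
Qed.

Lemma computable_subst4 f m A B C D :
  computable 4 (fun v => f (nth 0 v 0) (nth 0 v 1) (nth 0 v 2) (nth 0 v 3)) ->
  computable m A -> computable m B -> computable m C -> computable m D ->
  computable m (fun v => f (A v) (B v) (C v) (D v)).
Proof.
rewrite -[4]/(size [:: 0; 1; 2; 3]).
move=> /(computable_comp (G := fun i v => nth 0 [:: A v; B v; C v; D v] i)) + cA cB cC cD.
by apply=> -[|[|[|[|i]]]].
Qed.

(** Access to a variable from below [d] binders, in the form that nested bounded quantifiers
    produce. *)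
Lemma computable_var d m i : computable m (fun v => nth 0 (iter d behead v) i).
Proof.
apply: (computable_ext _ (computable_nth m (i + d))) => v _.
by elim: d i => [|d IH] i; rewrite ?addn0 //= nth_behead -IH addSnnS.
Qed.

Ltac computable_leaf := first
  [ exact: (computable_nth _ _) | exact: (computable_var 1 _ _)
  | exact: (computable_var 2 _ _) | exact: (computable_var 3 _ _)
  | exact: (computable_var 4 _ _) | exact: (computable_var 5 _ _)
  | exact: (computable_const _ _) ].

Ltac computable_step := first
  [ computable_leaf | apply: computable_all | apply: computable_has
  | apply: computable_count | apply: computable_max
  | apply: computable_succ | apply: computable_pred
  | apply: computable_add | apply: computable_sub | apply: computable_mul
  | apply: computable_exp | apply: computable_fact | apply: computable_div
  | apply: computable_mod | apply: computable_leq | apply: computable_eqn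
  | apply: computable_andb | apply: computable_negb ].

Lemma computable_code_head : computable 1 (fun v => code_head (nth 0 v 0)).
Proof. rewrite /code_head; repeat computable_step. Qed.

Lemma computable_code_tail : computable 1 (fun v => code_tail (nth 0 v 0)).
Proof.
rewrite /code_tail.
repeat first [computable_leaf
  | apply: (computable_subst1 computable_code_head) | computable_step].
Qed.

Lemma computable_iter_tail m N F : computable m N -> computable m F ->
  computable m (fun v => iter (N v) code_tail (F v)).
Proof.
move=> cN cF; apply: computable_iter => // m' A.
exact: (computable_subst1 computable_code_tail).
Qed.

Lemma computable_code_nth :
  computable 2 (fun v => code_nth (nth 0 v 0) (nth 0 v 1)).
Proof.
apply: (computable_subst1 computable_code_head).
by apply: computable_iter_tail; computable_leaf.
Qed.

Lemma computable_code_size : computable 1 (fun v => code_size (nth 0 v 0)).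
Proof.
rewrite /code_size; repeat first [computable_leaf
  | apply: computable_iter_tail | computable_step].
Qed.

Lemma computable_shifted_coef :
  computable 2 (fun v => shifted_coef (nth 0 v 0) (nth 0 v 1)).
Proof.
rewrite /shifted_coef.
repeat first [computable_leaf
  | apply: (computable_subst2 computable_code_nth) | computable_step].
Qed.

Lemma computable_digit :
  computable 3 (fun v => digit (nth 0 v 0) (nth 0 v 1) (nth 0 v 2)).
Proof. rewrite /digit; repeat computable_step. Qed.

Lemma computable_digit_bound :
  computable 3 (fun v => digit_bound (nth 0 v 0) (nth 0 v 1) (nth 0 v 2)).
Proof. rewrite /digit_bound /spread; repeat computable_step. Qed.

Lemma computable_hilbert_search :
  computable 3 (fun v => hilbert_search (nth 0 v 0) (nth 0 v 1) (nth 0 v 2)).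
Proof.
rewrite /hilbert_search /tropical_solb /fresh_residues.
repeat first [computable_leaf
  | apply: (computable_subst2 computable_shifted_coef)
  | apply: (computable_subst3 computable_digit)
  | apply: (computable_subst3 computable_digit_bound) | computable_step].
Qed.

Lemma computable_hilbert_table_code : computable 3 (fun v =>
  hilbert_table_code (nth 0 v 0) (nth 0 v 1) (nth 0 v 2)).
Proof.
rewrite /hilbert_table_code; apply: (computable_rec (G := fun i h v =>
  2 ^ hilbert_search (nth 0 v 0) (nth 0 v 1) (nth 0 v 2 - i.+1) * (h + h).+1)).
- exact: computable_nth.
- exact: computable_const.
- repeat first [computable_leaf
  | apply: (computable_subst3 computable_hilbert_search) | computable_step].
Qed.

Lemma computable_hilbert_output : computable 4 (fun v =>
  hilbert_output (nth 0 v 0) (nth 0 v 1) (nth 0 v 2) (nth 0 v 3)).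
Proof.
rewrite /hilbert_output; repeat first [computable_leaf
  | apply: (computable_subst3 computable_hilbert_search)
  | apply: (computable_subst3 computable_hilbert_table_code) | computable_step].
Qed.

Lemma computable_hilbert_program :
  computable 1 (fun v => hilbert_program (nth 0 v 0)).
Proof.
have cn : computable 1 (fun v => (code_size (nth 0 v 0)).-1).
  exact: computable_pred computable_code_size.
have cS : computable 2 (fun v => region_count (nth 0 v 0) (nth 0 v 1)).
  rewrite /region_count /spread; repeat computable_step.
have cP : computable 2 (fun v => hilbert_period (nth 0 v 0) (nth 0 v 1)).
  exact: computable_fact.
have cM : computable 2 (fun v => hilbert_preperiod (nth 0 v 0) (nth 0 v 1)).
  rewrite /hilbert_preperiod /max_walk_preperiod.
  repeat first [computable_leaf
  | apply: (computable_subst2 cS) | computable_step].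
rewrite /hilbert_program; apply: (computable_subst4 computable_hilbert_output) => //.
- exact: computable_nth.
- by apply: (computable_subst2 cM) => //; apply: computable_nth.
- by apply: (computable_subst2 cP) => //; apply: computable_nth.
Qed.

(** * Correctness of the coding of lists and coefficients *)

Lemma code_cons n s : CodeSeq.code (n :: s) = 2 ^ n * (CodeSeq.code s).*2.+1.
Proof. by []. Qed.

Lemma code_headE h t : code_head (2 ^ h * t.*2.+1) = h.
Proof.
rewrite /code_head (eq_count (a2 := fun i => i < h)); last first.
  move=> i /=; apply/idP/idP; last first.
    by move=> ih; rewrite -(subnKC ih) expnD -mulnA modnMr.
  apply: contraTT; rewrite -leqNgt => hi.
  rewrite -/(dvdn _ _); apply/negP => /(dvdn_trans (dvdn_exp2l 2 (_ : h.+1 <= i.+1))).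
  by move=> /(_ hi); rewrite expnSr dvdn_pmul2l ?expn_gt0 // dvdn2 /= odd_double.
rewrite count_ltn_iota //; apply: leq_trans (leq_pmulr _ _) => //.
exact: ltnW (ltn_expl _ _).
Qed.

Lemma code_tailE h t : code_tail (2 ^ h * t.*2.+1) = t.
Proof.
rewrite /code_tail code_headE expnSr divnMA mulKn ?expn_gt0 //.
by rewrite divn2 /= uphalf_double.
Qed.

Lemma iter_code_tail s i :
  iter i code_tail (CodeSeq.code s) = CodeSeq.code (drop i s).
Proof.
elim: i s => [|i IH] s; first by rewrite drop0.
rewrite iterSr; case: s => [|x s]; last by rewrite code_cons code_tailE IH.
have -> : code_tail (CodeSeq.code [::]) = CodeSeq.code [::] by rewrite /code_tail div0n.
by rewrite IH; case: (i).
Qed.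

Lemma code_nthE s i : code_nth (CodeSeq.code s) i = nth 0 s i.
Proof.
have -> : nth 0 s i = nth 0 (drop i s) 0 by rewrite nth_drop addn0.
rewrite /code_nth iter_code_tail; case: (drop i s) => [|x t]; first by [].
by rewrite code_cons code_headE.
Qed.

Lemma code_sizeE s : code_size (CodeSeq.code s) = size s.
Proof.
rewrite /code_size (eq_count (a2 := fun i => i < size s)) => [|i]; last first.
  rewrite iter_code_tail; case: (ltnP i (size s)) => iS.
    by rewrite (drop_nth 0) // code_cons muln_gt0 expn_gt0.
  by rewrite drop_oversize.
rewrite count_ltn_iota //; elim: s => // x s IH; rewrite code_cons.
apply: leq_trans (leq_pmull _ _); rewrite ?expn_gt0 // ltnS.
by apply: leq_trans IH _; rewrite -addnn leq_addr.
Qed.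

Lemma hilbert_table_codeE c n N :
  hilbert_table_code c n N = CodeSeq.code (mkseq (hilbert_search c n) N).
Proof.
suff : forall M, M <= N -> nat_rec _ 0 (fun i h =>
   2 ^ hilbert_search c n (N - i.+1) * (h + h).+1) M =
   CodeSeq.code [seq hilbert_search c n i | i <- iota (N - M) M].
  by move/(_ N (leqnn N)); rewrite subnn.
elim=> // M IH MN; rewrite /= IH ?(ltnW MN) // addnn -subSn //.
Qed.

Lemma vector_code_ge n (a : n.+1.-tuple int) i :
  (`|tnth a i| <= vector_code a)%N.
Proof.
have /allP := CodeSeq.ltn_code (map int_code a) => /(_ (int_code (tnth a i))).
move=> /(_ (map_f _ (mem_tnth _ _))) /ltnW; apply: leq_trans.
case: (tnth a i) => m /=; rewrite -addnn /= ?absz_nat; lia.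
Qed.

Lemma shifted_coefE n (a : n.+1.-tuple int) (i : 'I_n.+1) :
  (shifted_coef (vector_code a) i : int) = (tnth a i + vector_code a)%R.
Proof.
rewrite /shifted_coef code_nthE (nth_map 0%R) ?size_tuple // -tnth_nth.
have := vector_code_ge a i.
move: (vector_code a) => c; case: (tnth a i) => m; rewrite [int_code _]/= -muln2.
  by rewrite modnMl mulnK //; lia.
have [-> ->] : (m * 2).+1 %% 2 = 1 /\ (m * 2).+1 %/ 2 = m by lia.
lia.
Qed.

Local Open Scope ring_scope.

(** * The dimension as a number of classes modulo 1 *)

(** Indexing by all of [nat] allows windows to be shifted without casts; only the entries before [k]
    are constrained. *)
Definition tropical_sol (R : realType) (n k : nat) (a : nat -> int)
    (z : nat -> R) : Prop :=
  forall j, (j + n < k)%N -> exists i1 i2, [/\ (i1 <= n)%N, (i2 <= n)%N, i1 != i2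
    & forall i, (i <= n)%N -> z (j + i1)%N + (a i1)%:~R <= z (j + i)%N + (a i)%:~R
                 /\ z (j + i2)%N + (a i2)%:~R <= z (j + i)%N + (a i)%:~R].

Definition fresh (R : realType) (n : nat) (z : nat -> R) (t : nat) : bool :=
  all (fun s => ~~ ((t <= s + n)%N && (z t - z s \is a Num.int))) (iota 0 t).

Definition nfresh (R : realType) (n k : nat) (z : nat -> R) : nat :=
  count (fresh n z) (iota 0 k).

Definition coef (n : nat) (a : n.+1.-tuple int) (i : nat) : int := nth 0 a i.

Lemma freshP (R : realType) (n : nat) (z : nat -> R) (t : nat) :
  reflect (forall s, (s < t)%N -> (t <= s + n)%N -> z t - z s \isn't a Num.int)
    (fresh n z t).
Proof.
apply: (iffP allP) => h s.
  by move=> st tsn; have := h s; rewrite mem_iota tsn /= => ->.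
by rewrite mem_iota /= negb_and -implybE => st; apply/implyP; apply: h.
Qed.

Lemma nfresh_card (R : realType) (n k : nat) (z : nat -> R) :
  nfresh n k z = #|[set t : 'I_k | fresh n z t]|.
Proof.
rewrite /nfresh -sum1_count -sum1_card -[k in iota 0 k]subn0 big_mkord.
by apply: eq_bigl => t; rewrite inE.
Qed.

(** Provides perturbations below all positive gaps at once; the cap 1 also serves families without a
    positive member. *)
Lemma min_lower_bound (R : realType) (I : finType) (s : I -> R) :
  exists e : R, [/\ 0 < e, e <= 1 & forall i, 0 < s i -> e <= s i].
Proof.
exists (\big[Num.min/1]_(i | 0 < s i) s i); split.
- by apply/lt_bigmin.
- exact: bigmin_le_id.
- by move=> i si; apply: bigmin_le_cond.
Qed.

(** An arithmetic progression that makes the first edge of the lower Newton polygon of [a]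
    horizontal: every window then attains its minimum at both 0 and [i0.+1]. *)
Lemma exists_tropical_sol (R : realType) (n k : nat) (a : nat -> int) :
  (0 < n)%N -> exists z : nat -> R, tropical_sol n k a z.
Proof.
move=> n0; pose slope (i : 'I_n) : R := ((a i.+1)%:~R - (a 0%N)%:~R) / i.+1%:R.
pose i0 := [arg min_(i < Ordinal n0) slope i]%O.
have slopeE (i : 'I_n) : (a i.+1)%:~R = slope i * i.+1%:R + (a 0%N)%:~R.
  by rewrite /slope divfK ?subrK // pnatr_eq0.
exists (fun u => - slope i0 * u%:R) => j _; exists 0%N, i0.+1; split => //.
have e0 : (a i0.+1)%:~R = slope i0 * i0.+1%:R + (a 0%N)%:~R by apply: slopeE.
case=> [|i] ilen; rewrite !natrD e0; first by split; lra.
have -> := slopeE (Ordinal ilen) => /=.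
have : slope i0 <= slope (Ordinal ilen) by rewrite /i0; case: arg_minP => // l _; apply.
move: (slope i0) (slope _) => x y xy.
have := ler_wpM2r (ler0n R i.+1) xy; split; lra.
Qed.

Section Rows.
Variables (R : realType) (n : nat) (a : n.+1.-tuple int) (k : nat).

Definition row_seq (z : 'rV[R]_k) (t : nat) : R :=
  if insub t is Some u then z 0 u else 0.

Lemma row_seqE (z : 'rV[R]_k) (u : 'I_k) : row_seq z u = z 0 u.
Proof. by rewrite /row_seq valK. Qed.

Lemma window_lt (j : nat) : (j + n < k)%N = (j < k - n)%N.
Proof. by rewrite addnC ltn_subRL. Qed.

Lemma satisfies_seq (z : 'rV[R]_k) (y : nat -> R) :
  (forall u : 'I_k, z 0 u = y u) ->
  satisfies a z <-> tropical_sol n k (coef a) y.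
Proof.
move=> zy; split=> [sat j jk|sol j].
  rewrite window_lt in jk.
  have [i1 [i2 [i12 h]]] := sat (Ordinal jk).
  exists i1, i2; split; rewrite -?(ltnS _ n) ?ltn_ord ?(inj_eq val_inj) //.
  move=> i ile; have := h (Ordinal (ile : (i < n.+1)%N)).
  by rewrite !zy !(tnth_nth 0).
have := ltn_ord j; rewrite -window_lt => /sol[i1 [i2 [i1n i2n i12 h]]].
exists (Ordinal (i1n : (i1 < n.+1)%N)), (Ordinal (i2n : (i2 < n.+1)%N)); split.
  by rewrite -(inj_eq val_inj).
move=> i; have := h i; rewrite -ltnS ltn_ord => /(_ isT).
by rewrite !zy !(tnth_nth 0).
Qed.

End Rows.

Local Open Scope classical_set_scope.

(** [W] is a direction space of least dimension; intersecting it with the direction of another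
    affine subspace containing [P] cannot make it smaller. *)
Lemma affine_hull_exists (R : realType) (k : nat) (P : set 'rV[R]_k)
    (x : 'rV[R]_k) : P x ->
  exists W : {vspace 'rV[R]_k},
    [/\ has_affine_dim P (\dim W), (\dim W <= k)%N & P `<=` affine_subspace x W].
Proof.
move=> Px; pose Q d := `[< exists W : {vspace 'rV[R]_k},
  \dim W = d /\ P `<=` affine_subspace x W >].
have dimk (W : {vspace 'rV[R]_k}) : (\dim W <= k)%N.
  by apply: leq_trans (dimvS (subvf W)) _; rewrite dimvf /dim /= mul1n.
have exQ : exists d, Q d.
  exists (\dim (@fullv R 'rV[R]_k)); apply/asboolP; exists fullv.
  by split=> // z _; exact: memvf.
case: (ex_minnP exQ) => _ /asboolP[W [<- PW]] W_min.
exists W; split => //; split; first by exists x.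
exists x, W; split => // y W' PW' z /= zW.
have xyW' : x - y \in W' by exact: PW'.
rewrite /affine_subspace /=; have -> : z - y = (z - x) + (x - y) by rewrite addrA subrK.
apply: rpredD => //.
have : (\dim W <= \dim (W :&: W'))%N.
  apply: W_min; apply/asboolP; exists (W :&: W')%VS; split => // u Pu.
  have uW : u - x \in W := PW _ Pu; rewrite /affine_subspace /= memv_cap uW /=.
  have -> : u - x = (u - y) - (x - y) by rewrite opprB addrA subrK.
  by apply: rpredB xyW'; apply: PW'.
move=> dW; have /eqP eW : (W :&: W' == W)%VS by rewrite eqEdim capvSl.
by move: zW; rewrite /affine_subspace /= -eW memv_cap => /andP[].
Qed.

Lemma difference_polyhedron (R : realType) (k : nat) (I : finType)
    (s t : I -> 'I_k) (c : I -> R) :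
  polyhedron [set z : 'rV[R]_k | forall i, z 0 (s i) - z 0 (t i) <= c i].
Proof.
exists #|I|, (\matrix_(u, l) ((u == s (enum_val l))%:R - (u == t (enum_val l))%:R)).
exists (\row_l c (enum_val l)).
have E (z : 'rV[R]_k) l : (z *m \matrix_(u, l) ((u == s (enum_val l))%:R
    - (u == t (enum_val l))%:R)) 0 l = z 0 (s (enum_val l)) - z 0 (t (enum_val l)).
  have pick u0 : \sum_u z 0 u * (u == u0)%:R = z 0 u0.
    by rewrite (bigD1 u0) //= eqxx mulr1 big1 ?addr0 // => u /negPf ->; rewrite mulr0.
  rewrite mxE -!pick -sumrB; apply: eq_bigr => u _.
  by rewrite mxE mulrBr.
apply/seteqP; split=> z /= h.
  by move=> l; rewrite E mxE; apply: h.
by move=> i; have := h (enum_rank i); rewrite E mxE enum_rankK.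
Qed.

(** * The solution set as a finite union of polyhedra *)

Section Cells.
Variables (R : realType) (n : nat) (a : n.+1.-tuple int) (k : nat).

Local Notation val_at z j i :=
  ((z : 'rV[R]_k) 0 (window_index j i) + (tnth a i)%:~R).

Definition cell_index : Type :=
  {tau : {ffun 'I_(k - n) -> 'I_n.+1 * 'I_n.+1} |
    [forall j, (tau j).1 != (tau j).2]}.

Definition cell (tau : {ffun 'I_(k - n) -> 'I_n.+1 * 'I_n.+1}) : set 'rV[R]_k :=
  [set z | forall j i, val_at z j (tau j).1 <= val_at z j i
                    /\ val_at z j (tau j).2 <= val_at z j i].

Lemma cell_polyhedron tau : polyhedron (cell tau).
Proof.
pose I : finType := ('I_(k - n) * 'I_n.+1 * bool)%type.
pose m (x : I) := if x.2 then (tau x.1.1).1 else (tau x.1.1).2.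
have := difference_polyhedron (fun x : I => window_index x.1.1 (m x))
  (fun x => window_index x.1.1 x.1.2)
  (fun x => (tnth a x.1.2)%:~R - (tnth a (m x))%:~R : R).
congr polyhedron; apply/seteqP; split=> z /= h.
  by move=> j i; have := h (j, i, true); have := h (j, i, false); rewrite /m /=; split; lra.
by move=> [[j i] []]; rewrite /m /=; have [] := h j i; lra.
Qed.

Lemma solutions_cells : @tropical_solutions R n a k =
  \bigcup_(l : 'I_#|{: cell_index}|) cell (val (enum_val l)).
Proof.
apply/seteqP; split=> z; last first.
  move=> [l _ zl] j; exists (val (enum_val l) j).1, (val (enum_val l) j).2.
  by split; [exact: (forallP (valP (enum_val l)))|exact: zl].
move=> /= sat.
have /choice[f fP] : forall j : 'I_(k - n), exists p : 'I_n.+1 * 'I_n.+1,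
    p.1 != p.2 /\ forall i, val_at z j p.1 <= val_at z j i /\ val_at z j p.2 <= val_at z j i.
  by move=> j; have [i1 [i2 h]] := sat j; exists (i1, i2).
have ft : [forall j, ((finfun f) j).1 != ((finfun f) j).2].
  by apply/forallP => j; rewrite ffunE; have [] := fP j.
exists (enum_rank (Sub (finfun f) ft : cell_index)) => //.
by rewrite enum_rankK /= => j i; rewrite ffunE; have [_] := fP j; apply.
Qed.

End Cells.

(** * Dimension estimates for subspaces of row vectors *)

Section Dimension.
Variables (R : realType) (k : nat).

Definition delta_span (G : {set 'I_k}) : {vspace 'rV[R]_k} :=
  <<[seq delta_mx 0%R u | u <- enum G]>>%VS.

(** Coordinates as linear maps, so that [lker] turns equations between entries into subspaces. *)
Definition entry_hom (u : 'I_k) : 'Hom('rV[R]_k, 'M[R]_(1, 1)) :=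
  linfun (mulmxr (delta_mx u 0)).

Lemma entry_homE (u : 'I_k) (w : 'rV[R]_k) : entry_hom u w = (w 0 u)%:M.
Proof.
rewrite lfunE /= -colE; apply/matrixP => i j.
by rewrite !mxE !ord1 eqxx mulr1n.
Qed.

Lemma scalar_mx11_eq0 (x : R) : ((x%:M : 'M[R]_(1, 1)) == 0) = (x == 0).
Proof.
apply/eqP/eqP => [/matrixP/(_ 0 0)|->]; last by rewrite raddf0.
by rewrite !mxE eqxx mulr1n.
Qed.

Lemma mem_ker_entry (u : 'I_k) (w : 'rV[R]_k) :
  (w \in lker (entry_hom u)) = (w 0 u == 0).
Proof. by rewrite memv_ker entry_homE scalar_mx11_eq0. Qed.

Lemma mem_ker_entry_sub (u v : 'I_k) (w : 'rV[R]_k) :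
  (w \in lker (entry_hom u - entry_hom v)) = (w 0 u == w 0 v).
Proof.
rewrite memv_ker add_lfunE opp_lfunE !entry_homE -raddfB.
by rewrite scalar_mx11_eq0 subr_eq0.
Qed.

Lemma dim_delta_span (G : {set 'I_k}) : (\dim (delta_span G) <= #|G|)%N.
Proof. by apply: leq_trans (dim_span _) _; rewrite size_map -cardE. Qed.

Lemma mem_delta_span (G : {set 'I_k}) (u : 'I_k) :
  u \in G -> delta_mx 0 u \in delta_span G.
Proof. by move=> uG; apply/memv_span/map_f; rewrite mem_enum. Qed.

Lemma full_of_deltas (X : {vspace 'rV[R]_k}) :
  (forall u, delta_mx 0 u \in X) -> (k <= \dim X)%N.
Proof.
move=> dX; have : (fullv <= X)%VS.
  by apply/subvP => v _; rewrite [v]row_sum_delta; apply: rpred_sum => u _; apply: rpredZ.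
by move=> /dimvS; rewrite dimvf /dim /= mul1n.
Qed.

(** Together with the unit vectors outside [F], the subspace [W] spans everything, by descending
    induction on the position. *)
Lemma dim_ge_triangular (W : {vspace 'rV[R]_k}) (F : {set 'I_k}) :
  (forall t, t \in F -> exists x, [/\ x \in W, x 0 t = 1
     & forall u : 'I_k, (u < t)%N -> x 0 u = 0]) ->
  (#|F| <= \dim W)%N.
Proof.
move=> tri; have : (k <= \dim (W + delta_span (~: F)))%N.
  apply: full_of_deltas => t; have [m] := ubnP (k - t)%N.
  elim: m t => // m IH t tm; have [tF|tF] := boolP (t \in F); last first.
    by apply: (subvP (addvSr _ _)); apply: mem_delta_span; rewrite inE.
  have [x [xW xt x0]] := tri t tF.
  have ex : x = delta_mx 0 t + \sum_(u | u != t) x 0 u *: delta_mx 0 u.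
    by rewrite {1}[x]row_sum_delta (bigD1 t) //= xt scale1r.
  have -> : delta_mx 0 t = x - \sum_(u | u != t) x 0 u *: delta_mx 0 u.
    by rewrite {1}ex addrK.
  apply: rpredB; first exact: (subvP (addvSl _ _)).
  apply: rpred_sum => u ut; have [ltu|leu] := ltnP u t.
    by rewrite x0 // scale0r rpred0.
  apply/rpredZ/IH; have ltk := ltn_ord u.
  have : (t < u)%N by rewrite ltn_neqAle eq_sym leu andbT.
  by lia.
have := dimv_sum_cap W (delta_span (~: F)); have := dim_delta_span (~: F).
by have := cardsC F; rewrite card_ord; lia.
Qed.

(** [W] meets the span of the unit vectors outside [F] trivially, and that span has dimension at
    least [k - #|F|]. *)
Lemma dim_le_injective (W : {vspace 'rV[R]_k}) (F : {set 'I_k}) :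
  (forall w, w \in W -> (forall t, t \in F -> w 0 t = 0) -> w = 0) ->
  (\dim W <= #|F|)%N.
Proof.
move=> inj; set U := delta_span (~: F).
have U0 w t : w \in U -> t \in F -> w 0 t = 0.
  move=> wU tF; have : (U <= lker (entry_hom t))%VS.
    rewrite /U /delta_span; apply/span_subvP => x /mapP[u]; rewrite mem_enum inE => uF ->.
    rewrite mem_ker_entry mxE eqxx andTb; case: (t =P u) => [tu|_]; last by rewrite eqxx.
    by rewrite -tu tF in uF.
  by move=> /subvP/(_ _ wU); rewrite mem_ker_entry => /eqP.
have WU : (W :&: U = 0)%VS.
  apply/eqP; rewrite -subv0; apply/subvP => w; rewrite memv_cap memv0 => /andP[wW wU].
  by apply/eqP/inj => // t; apply: U0.
have : (\dim W + \dim U <= k)%N.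
  rewrite -dimv_disjoint_sum //; apply: leq_trans (dimvS (subvf _)) _.
  by rewrite dimvf /dim /= mul1n.
have : (k <= \dim (U + delta_span F))%N.
  apply: full_of_deltas => u; have [uF|uF] := boolP (u \in F).
    by apply: (subvP (addvSr _ _)); apply: mem_delta_span.
  by apply: (subvP (addvSl _ _)); apply: mem_delta_span; rewrite inE.
have := dimv_sum_cap U (delta_span F); have := dim_delta_span F; lia.
Qed.

End Dimension.

(** * Fresh entries bound the dimension from below *)

Section LowerBound.
Variables (R : realType) (n : nat) (a : n.+1.-tuple int) (k : nat).

Local Notation val_at z j i :=
  ((z : 'rV[R]_k) 0 (window_index j i) + (tnth a i)%:~R).

Lemma int_sub_trans (x y z : R) :
  x - y \is a Num.int -> y - z \is a Num.int -> x - z \is a Num.int.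
Proof.
move=> xy yz; have -> : x - z = (x - y) + (y - z) by rewrite addrA subrK.
exact: rpredD.
Qed.

Lemma int_subC (x y : R) : x - y \is a Num.int -> y - x \is a Num.int.
Proof. by move=> xy; rewrite -opprB rpredN. Qed.

(* No entry before a fresh [t] is within [n] of an entry after it and congruent
   to [t], so this direction preserves all ties of [y]. *)
Definition fresh_direction (y : nat -> R) (t : 'I_k) : 'rV[R]_k :=
  \row_u ((t <= u)%N && (y u - y t \is a Num.int))%:R.

Lemma fresh_direction_link (y : nat -> R) (t u v : 'I_k) : fresh n y t ->
  (u <= v + n)%N -> (v <= u + n)%N -> y u - y v \is a Num.int ->
  fresh_direction y t 0 u = fresh_direction y t 0 v.
Proof.
move=> /freshP ft.
have sub (u' v' : 'I_k) : (u' <= v' + n)%N -> y u' - y v' \is a Num.int ->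
    (t <= u')%N && (y u' - y t \is a Num.int) ->
    (t <= v')%N && (y v' - y t \is a Num.int).
  move=> uv iuv /andP[tu itu]; have ivt := int_sub_trans (int_subC iuv) itu.
  rewrite ivt andbT leqNgt; apply/negP => vt; have := ft v' vt.
  by rewrite (int_subC ivt) => /(_ (leq_trans tu uv)).
move=> uv vu iuv; rewrite !mxE; congr (_%:R); congr nat_of_bool.
by apply/idP/idP; apply: sub => //; apply: int_subC.
Qed.

(** A cell containing the solution also contains a short step in each direction
    [fresh_direction y t] with [t] fresh. These directions are triangular, so the affine hull of the
    cell is large enough. *)
Lemma nfresh_le_hilbert (y : nat -> R) : tropical_sol n k (coef a) y ->
  (nfresh n k y <= tropical_hilbert R a k)%N.
Proof.
move=> sol; pose z : 'rV[R]_k := \row_u y u.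
have zE (u : 'I_k) : z 0 u = y u by rewrite mxE.
have : tropical_solutions a z by apply/(satisfies_seq a zE).
rewrite solutions_cells => -[l _ zl].
have [W [hW Wk PW]] := affine_hull_exists zl.
have dimW : (nfresh n k y <= \dim W)%N.
  rewrite nfresh_card; apply: dim_ge_triangular => t; rewrite inE => ft.
  exists (fresh_direction y t); split; last 2 first.
  - by rewrite mxE leqnn subrr rpred0.
  - by move=> u ut; rewrite mxE leqNgt ut.
  set x := fresh_direction y t; set tau := val (enum_val l) in zl PW.
  pose I : finType := ('I_(k - n) * 'I_n.+1 * bool)%type.
  pose m (p : I) := if p.2 then (tau p.1.1).1 else (tau p.1.1).2.
  (* The entries of [x] lie in [0, 1], so moving by [e] times [x] closes a gap by at most [e] and
     reverses no strict inequality. *)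
  have [e [e0 e1 es]] := min_lower_bound (fun p : I =>
    val_at z p.1.1 p.1.2 - val_at z p.1.1 (m p)).
  have x01 u : 0 <= x 0 u <= 1 by rewrite mxE ler0n lern1 leq_b1.
  suff : cell a tau (z + e *: x).
    move=> /PW; rewrite /affine_subspace /= [z + _]addrC addrK => exW.
    by rewrite -[x]scale1r -(mulVf (lt0r_neq0 e0)) -scalerA rpredZ.
  suff h (p : I) : val_at (z + e *: x) p.1.1 (m p) <= val_at (z + e *: x) p.1.1 p.1.2.
    by move=> j i; split; [apply: (h (j, i, true)) | apply: (h (j, i, false))].
  have : val_at z p.1.1 (m p) <= val_at z p.1.1 p.1.2.
    by rewrite /m; case: p => [[j i] []] /=; have [] := zl j i.
  have [-> //|neq] := eqVneq (m p) p.1.2.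
  have E i : (z + e *: x) 0 i = y i + e * x 0 i by rewrite -zE mxE [(e *: x) _ _]mxE.
  (* The coefficients are integers, so tied entries are congruent modulo 1 and are moved equally by
     [x]. *)
  rewrite !E !zE le_eqVlt => /predU1P[eq_v|lt_v].
    suff -> : x 0 (window_index p.1.1 (m p)) = x 0 (window_index p.1.1 p.1.2).
      by move: eq_v; lra.
    apply: fresh_direction_link => //=.
    - by rewrite -addnA leq_add2l; apply: leq_trans (leq_ord _) (leq_addl _ _).
    - by rewrite -addnA leq_add2l; apply: leq_trans (leq_ord _) (leq_addl _ _).
    - have -> : y (p.1.1 + m p)%N - y (p.1.1 + p.1.2)%N =
          (tnth a p.1.2 - tnth a (m p))%:~R by rewrite rmorphB /=; move: eq_v => /=; lra.
      exact: intr_int.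
  have := es p; rewrite !zE subr_gt0 => /(_ lt_v).
  have /andP[x1 x2] := x01 (window_index p.1.1 (m p)).
  have /andP[x3 x4] := x01 (window_index p.1.1 p.1.2).
  have := mulr_ge0 (ltW e0) x3; have := ler_wpM2l (ltW e0) x2; lra.
apply: leq_trans dimW _; rewrite /tropical_hilbert /union_dim.
have Wk' : (\dim W < k.+1)%N by [].
apply: (@bigop.bigmax_sup _ (Ordinal Wk')) => //; apply/asboolP.
exists #|{: cell_index n k}|, (fun i => cell a (val (enum_val i))); split.
- by move=> i; apply: cell_polyhedron.
- exact: solutions_cells.
- by exists l.
Qed.

End LowerBound.

(** * Fresh entries bound the dimension from above *)

Lemma polyhedron_convex (R : realType) (k : nat) (P : set 'rV[R]_k)
    (z z' : 'rV[R]_k) (e : R) : polyhedron P -> P z -> P z' ->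
  0 <= e -> e <= 1 -> P (z + e *: (z' - z)).
Proof.
move=> [m [A [b ->]]] /= zP z'P e0 e1 i.
have -> : ((z + e *: (z' - z)) *m A) 0 i =
    (1 - e) * (z *m A) 0 i + e * (z' *m A) 0 i.
  by rewrite mulmxDl -scalemxAl mulmxBl !mxE; lra.
have := ler_wpM2l e0 (z'P i); have := zP i.
rewrite -[_ <= _]subr_ge0; have : 0 <= 1 - e by lra.
by move=> h1 h2; have := mulr_ge0 h1 h2; lra.
Qed.

(** For [x] not an integer, the shift is smaller than the distance to either neighbouring integer;
    for [x] an integer, it is nonzero and below 1 in absolute value. *)
Lemma small_shift_nonint (R : realType) (x r e : R) :
  `|r| < e -> e <= 1 -> (0 < x - (Num.floor x)%:~R -> e <= x - (Num.floor x)%:~R) ->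
  e <= 1 - (x - (Num.floor x)%:~R) ->
  (x \is a Num.int -> r != 0) -> x + r \isn't a Num.int.
Proof.
move=> re e1 h1 h2 hr; have [xi|xi] := boolP (x \is a Num.int).
  apply/negP => xr; have ri : r \is a Num.int.
    by rewrite -[r](addKr x) addrC; apply: rpredB.
  have := hr xi; move: (re); case/intrP: ri => m ->.
  rewrite -intr_norm => /lt_le_trans/(_ e1); rewrite ltrz1 intr_eq0; lia.
have x0 : 0 < x - (Num.floor x)%:~R.
  rewrite subr_gt0 lt_neqAle floor_le andbT.
  by apply: contra xi => /eqP <-; apply: intr_int.
apply/negP => /intrP[m em].
have e0 := h1 x0; move: re; rewrite ltr_norml => /andP[r1 r2].
have : (Num.floor x)%:~R < (m%:~R : R) by rewrite -em; lra.
have : (m%:~R : R) < (Num.floor x + 1)%:~R by rewrite -em rmorphD /=; lra.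
by rewrite !ltr_int; lia.
Qed.

Section Ties.
Variables (R : realType) (n : nat) (a : n.+1.-tuple int) (k : nat).

Local Notation val_at z j i :=
  ((z : 'rV[R]_k) 0 (window_index j i) + (tnth a i)%:~R).

Definition argmins (z : 'rV[R]_k) (j : 'I_(k - n)) : {set 'I_n.+1} :=
  [set i | [forall i', val_at z j i <= val_at z j i']].

Lemma argminsP z j i :
  reflect (forall i', val_at z j i <= val_at z j i') (i \in argmins z j).
Proof. by rewrite inE; apply: forallP. Qed.

Lemma satisfies_argmins z : satisfies a z ->
  forall j, exists i1 i2, [/\ i1 != i2, i1 \in argmins z j & i2 \in argmins z j].
Proof.
move=> sat j; have [i1 [i2 [i12 h]]] := sat j; exists i1, i2.
by split=> //; apply/argminsP => i; have [] := h i.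
Qed.

Lemma argmins_eq z j i1 i2 : i1 \in argmins z j -> i2 \in argmins z j ->
  val_at z j i1 = val_at z j i2.
Proof.
by move=> /argminsP h1 /argminsP h2; apply/le_anti/andP; split.
Qed.

Lemma argmins_lt z j i1 i : i1 \in argmins z j -> i \notin argmins z j ->
  val_at z j i1 < val_at z j i.
Proof.
move=> h1 h; rewrite lt_neqAle (argminsP _ _ _ h1) andbT.
by apply: contraNneq h => e; apply/argminsP => i'; rewrite -e; apply/argminsP.
Qed.

Definition argmin_link (z : 'rV[R]_k) (u v : 'I_k) : bool :=
  [exists j, [exists i1 in argmins z j, [exists i2 in argmins z j,
    (u == window_index j i1) && (v == window_index j i2)]]].

Lemma argmin_linkP z u v : reflect (exists j i1 i2,
    [/\ i1 \in argmins z j, i2 \in argmins z j,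
        u = window_index j i1 & v = window_index j i2]) (argmin_link z u v).
Proof.
apply: (iffP existsP).
  move=> [j /exists_inP[i1 h1 /exists_inP[i2 h2 /andP[/eqP -> /eqP ->]]]].
  by exists j, i1, i2.
move=> [j [i1 [i2 [h1 h2 -> ->]]]]; exists j.
by apply/exists_inP; exists i1 => //; apply/exists_inP; exists i2; rewrite ?eqxx.
Qed.

Lemma argmin_link_sym z : symmetric (argmin_link z).
Proof.
by move=> u v; apply/argmin_linkP/argmin_linkP => -[j [i1 [i2 [h1 h2 -> ->]]]];
  exists j, i2, i1.
Qed.

(** A small move from [z] towards [z'] stays in [P] and creates no minimizer. As [z] has the fewest,
    none is lost either, so every tie persists along the segment and its direction is constant on
    ties. *)
Lemma tie_minimal_link (P : set 'rV[R]_k) (z z' : 'rV[R]_k) :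
  polyhedron P -> P `<=` @tropical_solutions R n a k -> P z -> P z' ->
  (forall y, P y -> (\sum_j #|argmins z j| <= \sum_j #|argmins y j|)%N) ->
  forall u v, argmin_link z u v -> (z' - z) 0 u = (z' - z) 0 v.
Proof.
move=> polP PD Pz Pz' z_min.
pose I : finType := ('I_(k - n) * 'I_n.+1 * 'I_n.+1)%type.
pose s (p : I) := val_at z p.1.1 p.1.2 - val_at z p.1.1 p.2.
pose s' (p : I) := val_at z' p.1.1 p.1.2 - val_at z' p.1.1 p.2.
(* The gap [s p] becomes (1 - e) s + e s' at the new point; this bound on [e] keeps it positive. *)
have [e [e0 e1 es]] := min_lower_bound (fun p => s p / (1 + s p + `|s' p|)).
set y := z + e *: (z' - z).
have Py : P y by apply: polyhedron_convex => //; apply: ltW.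
have yE u : y 0 u = (1 - e) * z 0 u + e * z' 0 u.
  by rewrite !mxE; lra.
have sub j : argmins y j \subset argmins z j.
  apply/fintype.subsetP => i iy; apply: contraT => iz.
  have [i0 [_ [_ i0z _]]] := satisfies_argmins (PD _ Pz) j.
  have := argmins_lt i0z iz; rewrite -subr_gt0 -/(s (j, i, i0)) => s0.
  have := argminsP _ _ _ iy i0.
  have d0 : 0 < 1 + s (j, i, i0) + `|s' (j, i, i0)|.
    by have := normr_ge0 (s' (j, i, i0)); lra.
  have := es (j, i, i0); rewrite divr_gt0 // => /(_ isT).
  rewrite ler_pdivlMr // => es0.
  have := ler_norm (- s' (j, i, i0)); rewrite normrN => ns.
  have := ler_wpM2l (ltW e0) ns.
  rewrite !yE; move: es0 s0; rewrite /s /s' /=; nra.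
have eq_arg j : argmins y j = argmins z j.
  apply/eqP; rewrite eqEcard sub /= leqNgt; apply/negP => lt_j.
  have := z_min y Py; rewrite leqNgt => /negP; apply.
  rewrite (bigD1 j) //= [X in (_ < X)%N](bigD1 j) //= -addSn leq_add //.
  by apply: leq_sum => i _; apply: subset_leq_card.
move=> u v /argmin_linkP[j [i1 [i2 [h1 h2 -> ->]]]].
have ez := argmins_eq h1 h2; rewrite -eq_arg in h1; rewrite -eq_arg in h2.
have := argmins_eq h1 h2; rewrite !yE => ey.
apply: (mulfI (lt0r_neq0 e0)); rewrite !mxE.
by move: ez ey; nra.
Qed.

End Ties.

(** The first alternative is the default value of an empty maximum; a nonempty one is attained. *)
Lemma union_dim_presentation (R : realType) (k : nat) (S : set 'rV[R]_k) :
  union_dim S = 0%N \/ exists (N : nat) (P : 'I_N -> set 'rV[R]_k) i,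
    [/\ forall i, polyhedron (P i), S = \bigcup_i P i
      & has_affine_dim (P i) (union_dim S)].
Proof.
pose C (d : 'I_k.+1) := `[< exists (N : nat) (P : 'I_N -> set 'rV[R]_k),
  [/\ forall i, polyhedron (P i), S = \bigcup_i P i
    & exists i, has_affine_dim (P i) d] >].
have -> : union_dim S = (\max_(d < k.+1 | C d) d)%N by [].
have [C0|C0] := posnP #|C|.
  by left; rewrite big_pred0 // => d; apply: (card0_eq C0).
right; have [d /asboolP[N [P [polP eP [i hP]]]] ->] := eq_bigmax_cond val C0.
by exists N, P, i.
Qed.

Section Attained.
Variables (R : realType) (n : nat) (a : n.+1.-tuple int) (k : nat).

Local Notation val_at z j i :=
  ((z : 'rV[R]_k) 0 (window_index j i) + (tnth a i)%:~R).

(* Moving each class of tied entries by its own small amount keeps the tie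
   pattern and separates the classes modulo 1. *)
Lemma separate_classes (z : 'rV[R]_k) : satisfies a z ->
  exists y : nat -> R, tropical_sol n k (coef a) y /\
    forall u v : 'I_k, y u - y v \is a Num.int -> connect (argmin_link a z) u v.
Proof.
move=> sat; set e := argmin_link a z.
have csym : connect_sym e by apply/sym_connect_sym/argmin_link_sym.
pose th (u : 'I_k) : R := (fingraph.root e u : nat)%:R.
pose I : finType := ('I_(k - n) * 'I_n.+1 * 'I_n.+1)%type.
have [e1 [e1p e1le e1s]] := min_lower_bound (fun p : I =>
  val_at z p.1.1 p.1.2 - val_at z p.1.1 p.2).
pose fr (p : 'I_k * 'I_k) := z 0 p.1 - z 0 p.2 - (Num.floor (z 0 p.1 - z 0 p.2))%:~R.
have [e2 [e2p e2le e2s]] := min_lower_bound fr.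
have [e3 [e3p e3le e3s]] := min_lower_bound (fun p => 1 - fr p).
(* [e1] protects the strict inequalities in windows, [e2] and [e3] the distances to the integers
   below and above. As [th] takes values in [0, k], dividing by [k.+1] keeps all relative shifts
   below [ep]. *)
pose ep := Num.min e1 (Num.min e2 e3).
have epp : 0 < ep by rewrite !lt_min e1p e2p e3p.
have [ep1 ep2 ep3] : [/\ ep <= e1, ep <= e2 & ep <= e3].
  by split; rewrite /ep !ge_min lexx ?orbT.
pose d := ep / k.+1%:R.
have dp : 0 < d by rewrite divr_gt0.
have th_lt u v : `|d * (th u - th v)| < ep.
  rewrite normrM (gtr0_norm dp) /d mulrAC ltr_pdivrMr // ltr_pM2l //.
  have /andP[u1 u2] : 0 <= th u <= k%:R by rewrite ler0n ler_nat ltnW.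
  have /andP[v1 v2] : 0 <= th v <= k%:R by rewrite ler0n ler_nat ltnW.
  by rewrite -natr1 ltr_norml; lra.
have th_link u v : e u v -> th u = th v.
  move=> uv; rewrite /th (eqP (_ : fingraph.root e u == fingraph.root e v)) //.
  by rewrite root_connect // connect1.
pose zr : 'rV[R]_k := \row_u (z 0 u + d * th u).
have zrE u : zr 0 u = z 0 u + d * th u by rewrite mxE.
exists (row_seq zr); split.
  apply/(@satisfies_seq R n a k zr) => [u|j]; first by rewrite row_seqE.
  have [i1 [i2 [i12 h1 h2]]] := satisfies_argmins sat j.
  suff h i0 i : i0 \in argmins a z j -> val_at zr j i0 <= val_at zr j i.
    by exists i1, i2; split => // i; split; apply: h.
  move=> h0; rewrite !zrE; have [hi|hi] := boolP (i \in argmins a z j).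
    have -> : th (window_index j i0) = th (window_index j i).
      by apply: th_link; apply/argmin_linkP; exists j, i0, i.
    by have := argmins_eq h0 hi; lra.
  have := argmins_lt h0 hi; rewrite -subr_gt0 => /(e1s (j, i, i0)) /=.
  have := th_lt (window_index j i0) (window_index j i).
  by rewrite ltr_norml mulrBr => /andP[_]; lra.
move=> u v; rewrite !row_seqE !zrE => uv; rewrite -/e -(root_connect csym).
apply: contraTT uv => neq.
have -> : z 0 u + d * th u - (z 0 v + d * th v) =
    (z 0 u - z 0 v) + d * (th u - th v) by rewrite mulrBr; lra.
apply: (small_shift_nonint (th_lt u v)).
- by apply: le_trans ep1 e1le.
- by move=> /(e2s (u, v)); apply: le_trans.
- apply: le_trans ep3 (e3s (u, v) _); rewrite /fr /= subr_gt0.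
  by have := floorD1_gt (z 0 u - z 0 v); rewrite intrD; lra.
- by move=> _; apply: mulf_neq0; [rewrite gt_eqF | rewrite subr_eq0 eqr_nat].
Qed.

(** At a point of [P] with the fewest ties, every vector of the direction space is constant on
    classes of ties. Once the classes are separated modulo 1, such a vector is determined by its
    fresh entries. *)
Lemma affine_dim_le_nfresh (P : set 'rV[R]_k) (d : nat) :
  polyhedron P -> P `<=` @tropical_solutions R n a k -> has_affine_dim P d ->
  exists y : nat -> R, tropical_sol n k (coef a) y /\ (d <= nfresh n k y)%N.
Proof.
move=> polP PD [[z0 Pz0] [x [W [<- PW hull]]]].
pose Q m := `[< exists z, P z /\ (\sum_j #|argmins a z j| = m)%N >].
have exQ : exists m, Q m by eexists; apply/asboolP; exists z0.
case: (ex_minnP exQ) => _ /asboolP[z [Pz <-]] z_min.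
have W_link w u v : w \in W -> argmin_link a z u v -> w 0 u = w 0 v.
  move=> wW uv; set L := lker (entry_hom R u - entry_hom R v).
  (* As [P] lies in z + L, so does its affine hull x + W; hence [W] is contained in [L]. *)
  have /hull sub : P `<=` affine_subspace z L.
    move=> z' Pz'; rewrite /affine_subspace /= mem_ker_entry_sub.
    apply/eqP; apply: (tie_minimal_link polP PD Pz Pz') uv => y Py.
    by apply: z_min; apply/asboolP; exists y.
  have xL : x - z \in L by apply: sub; rewrite /affine_subspace /= subrr mem0v.
  have xwL : x + w - z \in L by apply: sub; rewrite /affine_subspace /= addrC addKr.
  apply/eqP; rewrite -mem_ker_entry_sub -/L.
  have -> : w = (x + w - z) - (x - z) by rewrite opprB addrA subrK addrC addKr.
  exact: rpredB.
have [y [sol cls]] := separate_classes (PD _ Pz).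
exists y; split => //; rewrite nfresh_card; apply: dim_le_injective => w wW w0.
have W_connect u v : connect (argmin_link a z) u v -> w 0 u = w 0 v.
  move=> /connectP[p]; elim: p u => [|t p IH] u /=; first by move=> _ ->.
  by move=> /andP[ut pt] lv; rewrite (W_link _ _ _ wW ut); apply: IH.
(* Strong induction on [t]: an entry that is not fresh is tied, through a chain, to an earlier
   one. *)
apply/rowP => t; rewrite mxE; have [m] := ubnP (t : nat).
elim: m t => // m IH t tm; have [ft|] := boolP (fresh n y t).
  by apply: w0; rewrite inE.
move=> /allPn[s]; rewrite mem_iota /= negbK => st /andP[_ int_ts].
have sk := ltn_trans st (ltn_ord t).
rewrite (W_connect t (Ordinal sk)); first by apply: IH; apply: leq_trans st _.
exact: cls.
Qed.

Lemma hilbert_attained : (0 < n)%N -> exists y : nat -> R,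
  tropical_sol n k (coef a) y /\ tropical_hilbert R a k = nfresh n k y.
Proof.
move=> n0; suff [y [sol le_y]] : exists y : nat -> R, tropical_sol n k (coef a) y /\
    (tropical_hilbert R a k <= nfresh n k y)%N.
  exists y; split => //; apply/eqP; rewrite eqn_leq le_y.
  exact: nfresh_le_hilbert.
have [N0|[N [P [i [polP eP hP]]]]] := union_dim_presentation (@tropical_solutions R n a k).
  have [y sol] := exists_tropical_sol R k (coef a) n0.
  by exists y; rewrite /tropical_hilbert N0.
apply: (affine_dim_le_nfresh (polP i) _ hP) => z Pz.
by rewrite eP; exists i.
Qed.

End Attained.

(** * Solutions with bounded windows *)

Lemma sub_int_iff (R : realType) (x y : R) (m : int) :
  x - y = m%:~R -> (x \is a Num.int) = (y \is a Num.int).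
Proof.
move=> e; have mi : x - y \is a Num.int by rewrite e intr_int.
by apply/idP/idP => h; [have -> : y = x - (x - y) by rewrite opprB addrC subrK
  | rewrite -(subrK y x)]; [apply: rpredB | apply: rpredD].
Qed.

Lemma nfresh_int_shift (R : realType) (n k : nat) (z : nat -> R) (m : nat -> int) :
  nfresh n k (fun u => z u - (m u)%:~R) = nfresh n k z.
Proof.
apply: eq_count => t; apply: eq_all => s; congr (~~ (_ && _)).
apply: (@sub_int_iff _ _ _ (m s - m t)); rewrite rmorphB /=; lra.
Qed.

Lemma int_coef_bounds (R : realType) (x : int) (A : nat) : (`|x| <= A)%N ->
  - A%:R <= (x%:~R : R) <= A%:R.
Proof.
by move=> xA; rewrite -[A%:R]/((A : int)%:~R) -rmorphN !ler_int /=; lia.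
Qed.

Section Bounding.
Variables (R : realType) (n k A : nat) (a : nat -> int) (z : nat -> R).
Hypothesis aA : forall i, (i <= n)%N -> (`|a i| <= A)%N.
Hypothesis nk : (n < k)%N.
Variables (mu : nat -> R).
Hypothesis mu_le : forall j i, (j + n < k)%N -> (i <= n)%N ->
  mu j <= z (j + i)%N + (a i)%:~R.
Hypothesis mu_att : forall j, (j + n < k)%N -> exists i1 i2,
  [/\ (i1 <= n)%N, (i2 <= n)%N, i1 != i2, z (j + i1)%N + (a i1)%:~R = mu j
    & z (j + i2)%N + (a i2)%:~R = mu j].

(* Consecutive windows share an entry attaining either minimum. *)
Lemma window_min_step j : (j.+1 + n < k)%N ->
  mu j.+1 <= mu j + 2 * A%:R /\ mu j <= mu j.+1 + 2 * A%:R.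
Proof.
move=> jk; have jk' : (j + n < k)%N by lia.
split.
  have [i [i0 ilen ei]] : exists i, [/\ (0 < i)%N, (i <= n)%N
      & z (j + i)%N + (a i)%:~R = mu j].
    have [i1 [i2 [h1 h2 h12 e1 e2]]] := mu_att jk'.
    case: i1 h1 h12 e1 => [|i1] h1 h12 e1; [exists i2|exists i1.+1]; split;
      by rewrite // lt0n eq_sym.
  have ip : (i.-1 <= n)%N by lia.
  have := mu_le jk ip; rewrite addSnnS prednK //.
  have := int_coef_bounds R (aA ip); have := int_coef_bounds R (aA ilen).
  by move: ei; lra.
have [i [ilt ei]] : exists i, (i < n)%N /\ z (j.+1 + i)%N + (a i)%:~R = mu j.+1.
  have [i1 [i2 [h1 h2 h12 e1 e2]]] := mu_att jk.
  have [i1n|i1n] := ltnP i1 n; first by exists i1.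
  by exists i2; split => //; lia.
have := mu_le jk' ilt; rewrite -addSnnS.
have := int_coef_bounds R (aA (ltnW ilt)); have := int_coef_bounds R (aA ilt).
by move: ei; lra.
Qed.

Lemma window_min_lipschitz j j' d : (j + n < k)%N -> (j' + n < k)%N ->
  (j <= j' + d)%N -> (j' <= j + d)%N -> `|mu j - mu j'| <= 2 * A%:R * d%:R.
Proof.
have up e : forall i, (i + e + n < k)%N -> `|mu (i + e)%N - mu i| <= 2 * A%:R * e%:R.
  elim: e => [|e IH] i ik; first by rewrite addn0 subrr normr0 mulr0.
  have /IH : (i + e + n < k)%N by lia.
  rewrite addnS in ik *; have := window_min_step ik.
  rewrite -natr1 !ler_norml => -[h1 h2] /andP[h3 h4]; apply/andP; split; lra.
have mono e e' : (e <= e')%N -> 2 * A%:R * e%:R <= 2 * A%:R * e'%:R :> R.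
  by move=> ee; rewrite ler_wpM2l ?mulr_ge0 // ler_nat.
move=> jk jk' jd j'd; have [jj|jj] := leqP j j'.
  rewrite distrC -(subnKC jj); apply: le_trans (up _ _ _) (mono _ _ _); lia.
rewrite -(subnKC (ltnW jj)); apply: le_trans (up _ _ _) (mono _ _ _); lia.
Qed.

(** The start of a window containing [u]; the last window starts at [k - n.+1]. *)
Let home u := minn u (k - n.+1).
(** An entry this far above the minimum of its home window attains no minimum: minima of windows
    sharing an entry differ by at most 2 A n, and a coefficient is at least -A. *)
Let H : R := 2 * A%:R * n%:R + A%:R + 1.
Let active u := `[< exists j i, [/\ (j + n < k)%N, (i <= n)%N, u = (j + i)%N
  & z u + (a i)%:~R = mu j] >].
Let m u := if active u then 0 else Num.floor (z u - (mu (home u) + H)).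
Let z' u := z u - (m u)%:~R.

Lemma home_window u : (u < k)%N -> (home u + n < k)%N /\ (home u <= u <= home u + n)%N.
Proof. by rewrite /home; lia. Qed.

Lemma lowered_bounds u : (u < k)%N -> ~~ active u ->
  mu (home u) + H <= z' u < mu (home u) + H + 1.
Proof.
move=> uk /negPf na; rewrite /z' /m na.
have := floor_le (z u - (mu (home u) + H)).
have := floorD1_gt (z u - (mu (home u) + H)).
by rewrite intrD; move=> h1 h2; apply/andP; split; lra.
Qed.

(** Entries attaining a minimum are not moved, and the others are placed above all minima. *)
Lemma lowered_sol : tropical_sol n k a z'.
Proof.
move=> j jk; have [i1 [i2 [h1 h2 h12 e1 e2]]] := mu_att jk.
exists i1, i2; split => //.
have z'_att i : (i <= n)%N -> z (j + i)%N + (a i)%:~R = mu j ->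
    z' (j + i)%N + (a i)%:~R = mu j.
  move=> ilen ei; rewrite /z' /m.
  have -> : active (j + i) by apply/asboolP; exists j, i.
  by rewrite subr0.
suff h i : (i <= n)%N -> mu j <= z' (j + i)%N + (a i)%:~R.
  by move=> i ilen; rewrite (z'_att i1) // (z'_att i2) //; split; apply: h.
move=> ilen; have [act|nact] := boolP (active (j + i)).
  by rewrite /z' /m act subr0; apply: mu_le.
have uk : (j + i < k)%N by lia.
have [hk hu] := home_window uk.
have /andP[low _] := lowered_bounds uk nact.
have : `|mu j - mu (home (j + i))| <= 2 * A%:R * n%:R.
  by apply: window_min_lipschitz => //; lia.
have := int_coef_bounds R (aA ilen).
rewrite ler_norml; move: low; rewrite /H => low /andP[b1 b2] /andP[b3 b4]; lra.
Qed.

Lemma lowered_near u : (u < k)%N -> `|z' u - mu (home u)| <= H + 1.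
Proof.
move=> uk; have [hk hu] := home_window uk.
have A0 : 0 <= (A%:R : R) by [].
have An0 : 0 <= 2 * A%:R * n%:R :> R by rewrite !mulr_ge0.
have [act|nact] := boolP (active u); last first.
  have /andP[] := lowered_bounds uk nact; rewrite /H ler_norml => b1 b2.
  by apply/andP; split; lra.
rewrite /z' /m act subr0; move/asboolP: act => [j [i [jk ilen eu e]]]; subst u.
have : `|mu j - mu (home (j + i))| <= 2 * A%:R * n%:R.
  by apply: window_min_lipschitz => //; lia.
have := int_coef_bounds R (aA ilen).
rewrite /H !ler_norml => /andP[b1 b2] /andP[b3 b4].
by apply/andP; split; lra.
Qed.

Lemma lowered_spread s t : (s < k)%N -> (t < k)%N -> (s <= t + n)%N ->
  (t <= s + n)%N -> `|z' s - z' t| <= (spread A n)%:R.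
Proof.
move=> sk tk st ts; have [hsk hs] := home_window sk.
have [htk ht] := home_window tk.
have : `|mu (home s) - mu (home t)| <= 2 * A%:R * n%:R.
  by apply: window_min_lipschitz => //; rewrite /home; lia.
have := lowered_near sk; have := lowered_near tk.
rewrite /spread !natrD !natrM /H !ler_norml.
by move=> /andP[b1 b2] /andP[b3 b4] /andP[b5 b6]; apply/andP; split; lra.
Qed.

End Bounding.

Lemma bounded_sol (R : realType) (n k A : nat) (a : nat -> int) (z : nat -> R) :
  (forall i, (i <= n)%N -> (`|a i| <= A)%N) -> tropical_sol n k a z ->
  exists z' : nat -> R, [/\ tropical_sol n k a z', nfresh n k z' = nfresh n k z
    & forall s t, (s < k)%N -> (t < k)%N -> (s <= t + n)%N -> (t <= s + n)%N ->
        `|z' s - z' t| <= (spread A n)%:R].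
Proof.
move=> aA sol; have [kn|nk] := leqP k n.
  (* There is no window, so fractional parts suffice. *)
  exists (fun u => z u - (Num.floor (z u))%:~R); split.
  - by move=> j; lia.
  - exact: nfresh_int_shift.
  - move=> s t _ _ _ _; have := floor_le (z s); have := floor_le (z t).
    have := floorD1_gt (z s); have := floorD1_gt (z t); rewrite !intrD => h1 h2 h3 h4.
    have : (1 : R) <= (spread A n)%:R by rewrite ler1n /spread; lia.
    by rewrite ler_norml => h5; apply/andP; split; lra.
have /choice[f fP] : forall j, exists p : nat * nat, (j + n < k)%N ->
    [/\ (p.1 <= n)%N, (p.2 <= n)%N, p.1 != p.2
    & forall i, (i <= n)%N -> z (j + p.1)%N + (a p.1)%:~R <= z (j + i)%N + (a i)%:~R
                 /\ z (j + p.2)%N + (a p.2)%:~R <= z (j + i)%N + (a i)%:~R].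
  move=> j; have [jk|jk] := ltnP (j + n) k; last by exists (0, 0)%N; lia.
  by have [i1 [i2 h]] := sol j jk; exists (i1, i2).
pose mu j := z (j + (f j).1)%N + (a (f j).1)%:~R.
have mu_le j i : (j + n < k)%N -> (i <= n)%N -> mu j <= z (j + i)%N + (a i)%:~R.
  by move=> jk ilen; have [_ _ _ /(_ i ilen)[]] := fP j jk.
have mu_att j : (j + n < k)%N -> exists i1 i2,
  [/\ (i1 <= n)%N, (i2 <= n)%N, i1 != i2, z (j + i1)%N + (a i1)%:~R = mu j
    & z (j + i2)%N + (a i2)%:~R = mu j].
  move=> jk; have [h1 h2 h12 h] := fP j jk; exists (f j).1, (f j).2; split => //.
  apply/le_anti/andP; split; last exact: mu_le.
  by have [_] := h _ h1.
have sol' := @lowered_sol _ _ _ _ _ _ aA nk _ mu_le mu_att.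
have spread' := lowered_spread aA nk mu_le mu_att.
by eexists; split; [exact: sol' | exact: nfresh_int_shift | exact: spread'].
Qed.

(** * Regions of windows *)

Lemma floor_nonint_opp (R : realType) (x : R) : x \isn't a Num.int ->
  Num.floor (- x) = - Num.floor x - 1.
Proof.
move=> xi; apply: floor_def; rewrite subrK intrB !intrN.
have := floor_le x; have := floorD1_gt x; rewrite intrD => h1 h2.
apply/andP; split; first by lra.
rewrite ltrN2 lt_neqAle h2 andbT; apply: contra xi => /eqP <-; exact: intr_int.
Qed.

(** Makes congruence modulo 1 readable from the floors of the two opposite differences. *)
Lemma int_floorN (R : realType) (x : R) :
  (x \is a Num.int) = (Num.floor x + Num.floor (- x) == 0).
Proof.
have [xi|xi] := boolP (x \is a Num.int); first by rewrite floorN // subrr eqxx.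
by rewrite floor_nonint_opp //; apply/esym/negbTE; lia.
Qed.

(* A point can be added to a finite configuration compatibly with any other
   configuration having the same floors of differences: the new point has to
   avoid or to lie in finitely many unit intervals, and whether these
   intersect is decided by those floors. *)
Lemma extend_configuration (R : realType) (n : nat) (x u : nat -> R) :
  (0 < n)%N ->
  (forall i j, (i < n)%N -> (j < n)%N ->
     Num.floor (u i - u j) = Num.floor (x i - x j)) ->
  exists c, forall i, (i < n)%N -> Num.floor (c - u i) = Num.floor (x n - x i)
    /\ Num.floor (u i - c) = Num.floor (x i - x n).
Proof.
move=> n0 xu.
(* A point congruent to an earlier one has a forced position. *)
have [[i0 [i0n x0]]|noint] := pselect (exists i0, (i0 < n)%N /\ x n - x i0 \is a Num.int).
  case/intrP: x0 => m em; exists (u i0 + m%:~R) => i ilt.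
  have -> : u i0 + m%:~R - u i = (u i0 - u i) + m%:~R by lra.
  have -> : u i - (u i0 + m%:~R) = (u i - u i0) + (- m)%:~R by rewrite intrN; lra.
  have -> : x n - x i = (x i0 - x i) + m%:~R by rewrite -em; lra.
  have -> : x i - x n = (x i - x i0) + (- m)%:~R by rewrite intrN -em; lra.
  by rewrite !(floorDrz _ (intr_int _ _)) !xu.
pose f i := Num.floor (x n - x i).
have nonint i : (i < n)%N -> x n - x i \isn't a Num.int.
  by move=> ilt; apply/negP => h; apply: noint; exists i.
pose lo (i : 'I_n) : R := u i + (f i)%:~R.
pose i1 := [arg max_(i > Ordinal n0) lo i]%O; pose i2 := [arg min_(i < Ordinal n0) lo i]%O.
have lo1 i : lo i <= lo i1 by rewrite /i1; case: arg_maxP => // l _; apply.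
have lo2 i : lo i2 <= lo i by rewrite /i2; case: arg_minP => // l _; apply.
have lo12 : lo i1 < lo i2 + 1.
  have : x i1 - x i2 < (f i2 - f i1 + 1)%:~R.
    have := floor_le (x n - x i1); have := floorD1_gt (x n - x i2).
    rewrite -/(f i1) -/(f i2) !intrD intrN; lra.
  rewrite -floor_lt_int -xu // floor_lt_int !intrD intrN /lo; lra.
(* The open unit intervals starting at the [lo i] meet pairwise, so the midpoint between the largest
   lower end and the smallest upper end lies in all of them. *)
pose c := (lo i1 + lo i2 + 1) / 2; exists c => i ilt.
have c1 : lo (Ordinal ilt) < c by have := lo1 (Ordinal ilt); rewrite /c; lra.
have c2 : c < lo (Ordinal ilt) + 1 by have := lo2 (Ordinal ilt); rewrite /c; lra.
rewrite /lo /= in c1 c2.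
have e1 : Num.floor (c - u i) = f i.
  by apply: floor_def; rewrite intrD; apply/andP; split; lra.
split => //; rewrite -[u i - c]opprB -[x i - x n]opprB !floor_nonint_opp ?e1 //.
  exact: nonint.
apply/negP => /intrP[m em]; have : (f i)%:~R < (m%:~R : R) by rewrite -em; lra.
have : (m%:~R : R) < (f i + 1)%:~R by rewrite -em intrD; lra.
by rewrite !ltr_int; lia.
Qed.

(** With integer coefficients, comparisons inside a window depend only on floors of differences. *)
Lemma le_floor_sub (R : realType) (x y : R) (p q : int) :
  (x + p%:~R <= y + q%:~R) = (p - q <= Num.floor (y - x)).
Proof. by rewrite floor_ge_int intrB; apply/idP/idP; lra. Qed.

Lemma tropical_sol_floor (R : realType) (n : nat) (a : nat -> int)
    (x y : nat -> R) (j : nat) :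
  (forall i i', (i <= n)%N -> (i' <= n)%N ->
     Num.floor (y (j + i)%N - y (j + i')%N) = Num.floor (x i - x i')) ->
  tropical_sol n n.+1 a x -> exists i1 i2, [/\ (i1 <= n)%N, (i2 <= n)%N, i1 != i2
    & forall i, (i <= n)%N -> y (j + i1)%N + (a i1)%:~R <= y (j + i)%N + (a i)%:~R
                 /\ y (j + i2)%N + (a i2)%:~R <= y (j + i)%N + (a i)%:~R].
Proof.
move=> xy /(_ 0%N (ltnSn n))[i1 [i2 [h1 h2 h12 h]]]; exists i1, i2; split => // i ilen.
by have [] := h i ilen; rewrite !le_floor_sub !xy.
Qed.

Lemma fresh_shift (R : realType) (n : nat) (z : nat -> R) (j : nat) :
  fresh n z (j + n) = fresh n (fun i => z (j + i)%N) n.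
Proof.
apply/freshP/freshP => h s sn tn; first by apply: h; lia.
have js : (j <= s)%N by lia.
have -> : s = (j + (s - j))%N by lia.
by apply: h; lia.
Qed.

Section Regions.
Variables (R : realType) (n A : nat) (a : nat -> int).
Hypothesis n_gt0 : (0 < n)%N.

Local Notation B := (spread A n).

(* The floors of the differences inside a window, shifted by [B]. *)
Definition region : Type := {ffun 'I_n.+1 * 'I_n.+1 -> 'I_(2 * B).+1}.

Lemma card_region : #|{: region}| = region_count A n.
Proof. by rewrite card_ffun card_prod !card_ord. Qed.

Definition region_of (v : region) (x : nat -> R) : Prop :=
  forall i j : 'I_n.+1, Num.floor (x i - x j) = (v (i, j) : nat)%:Z - B%:Z.

Definition region_valid (v : region) : bool :=
  `[< exists x, tropical_sol n n.+1 a x /\ region_of v x >].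

(** Consecutive windows overlap: the last [n] entries of one are the first [n] of the next. *)
Definition region_step (v v' : region) : bool :=
  [&& region_valid v, region_valid v' &
    [forall i : 'I_n, [forall j : 'I_n,
      v (lift ord0 i, lift ord0 j) == v' (widen_ord (leqnSn n) i, widen_ord (leqnSn n) j)]]].

(** Two opposite floors add up to 0 exactly for an integer difference, that is, to [2 * B] after the
    shift. *)
Definition region_fresh (v : region) (t : nat) : bool :=
  all (fun s => (v (inord t, inord s) + v (inord s, inord t) != 2 * B)%N) (iota 0 t).

Definition region_weight (v : region) : nat := region_fresh v n.

(** Weight 0 on invalid regions, which no step leaves, keeps walks starting there below the Hilbert
    function. *)
Definition region_weight0 (v : region) : nat :=
  if region_valid v then count (region_fresh v) (iota 0 n.+1) else 0%N.

Lemma region_ofE v x i j : region_of v x -> (i <= n)%N -> (j <= n)%N ->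
  Num.floor (x i - x j) = (v (inord i, inord j) : nat)%:Z - B%:Z.
Proof. by move=> vx ilen jlen; rewrite -vx !inordK. Qed.

Lemma region_freshE v x t : region_of v x -> (t <= n)%N ->
  fresh n x t = region_fresh v t.
Proof.
move=> vx tn; apply: eq_in_all => s; rewrite mem_iota /= add0n => st.
have sn : (s <= n)%N by lia.
have -> : (t <= s + n)%N by lia.
rewrite /= int_floorN opprB !(region_ofE vx) //.
by congr (~~ _); apply/eqP/eqP; lia.
Qed.

Lemma region_exists (x : nat -> R) :
  (forall s t, (s <= n)%N -> (t <= n)%N -> `|x s - x t| <= B%:R) ->
  exists v, region_of v x.
Proof.
move=> xB; exists [ffun p : 'I_n.+1 * 'I_n.+1 =>
  inord (absz (Num.floor (x p.1 - x p.2) + B%:Z)%R)].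
move=> i j; rewrite ffunE /=.
have := xB i j (leq_ord i) (leq_ord j); rewrite ler_norml => /andP[h1 h2].
have f1 : - B%:Z <= Num.floor (x i - x j) by rewrite floor_ge_int intrN.
have f2 : Num.floor (x i - x j) <= B%:Z.
  by rewrite -(ler_int R); apply: le_trans (floor_le _) h2.
by rewrite inordK; lia.
Qed.

(** Induction on the walk: the last [n] entries built have the floors of the first [n] entries of a
    window realizing the next region, so one more point completes that window. *)
Lemma walk_realized v s : region_valid v -> path region_step v s ->
  exists z : nat -> R, tropical_sol n (n.+1 + size s) a z /\
    forall j, (j <= size s)%N -> region_of (nth v (v :: s) j) (fun i => z (j + i)%N).
Proof.
move=> vv; elim/last_ind: s => [|s w IH].
  move=> _; have /asboolP[x [sol vx]] := vv; exists x; rewrite addn0; split => //.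
  by case.
rewrite rcons_path => /andP[/IH[z [sol zv]] /and3P[_ /asboolP[x [solx wx]] /forallP step]].
set m := size s in sol zv *; have := zv m (leqnn _); rewrite -/(last v s).
rewrite -last_nth => zl.
have [|c cP] := @extend_configuration R n x (fun i => z (m + i.+1)%N) n_gt0.
  move=> i j ilt jlt.
  have := zl (lift ord0 (Ordinal ilt)) (lift ord0 (Ordinal jlt)).
  rewrite !lift0 /= => ->; have /forallP/(_ (Ordinal jlt))/eqP -> := step (Ordinal ilt).
  by rewrite -wx.
pose z' t := if t == (m.+1 + n)%N then c else z t.
have z'E t : (t < m.+1 + n)%N -> z' t = z t by move=> tl; rewrite /z' ltn_eqF.
have z'n : z' (m.+1 + n)%N = c by rewrite /z' eqxx.
have floors i i' : (i <= n)%N -> (i' <= n)%N ->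
    Num.floor (z' (m.+1 + i)%N - z' (m.+1 + i')%N) = Num.floor (x i - x i').
  rewrite [(i <= n)%N]leq_eqVlt [(i' <= n)%N]leq_eqVlt => /predU1P[->|ilt] /predU1P[->|i'lt].
  - by rewrite !subrr.
  - by rewrite z'n z'E ?ltn_add2l // addSnnS; have [] := cP _ i'lt.
  - by rewrite z'n z'E ?ltn_add2l // addSnnS; have [] := cP _ ilt.
  - rewrite !z'E ?ltn_add2l // !addSnnS.
    have := zl (lift ord0 (Ordinal ilt)) (lift ord0 (Ordinal i'lt)).
    rewrite !lift0 /= => ->; have /forallP/(_ (Ordinal i'lt))/eqP -> := step (Ordinal ilt).
    by rewrite -wx.
exists z'; rewrite size_rcons -/m; split.
  move=> j jk; have [jm|jm] := ltnP j m.+1; last first.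
    have -> : j = m.+1 by lia.
    exact: tropical_sol_floor floors solx.
  have [|i1 [i2 [h1 h2 h12 h]]] := sol j; first by lia.
  by exists i1, i2; split => // i ilen; rewrite !z'E; [apply: h | lia..].
move=> j; rewrite leq_eqVlt => /predU1P[->|jm].
  have -> : nth v (v :: rcons s w) m.+1 = w by rewrite /= nth_rcons ltnn eqxx.
  by move=> i i'; rewrite floors ?leq_ord //; apply: wx.
have -> : nth v (v :: rcons s w) j = nth v (v :: s) j.
  by rewrite -rcons_cons nth_rcons /= jm.
move=> i i'; have ii := ltn_ord i; have ii' := ltn_ord i'.
by rewrite !z'E; [apply: zv | lia..].
Qed.

(** The first window accounts for n + 1 entries; each step adds the last entry of its window, whose
    freshness is visible there. *)
Lemma walk_nfresh v s (z : nat -> R) : region_valid v ->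
  (forall j, (j <= size s)%N -> region_of (nth v (v :: s) j) (fun i => z (j + i)%N)) ->
  nfresh n (n.+1 + size s) z = (region_weight0 v + walk_weight region_weight s)%N.
Proof.
move=> vv zv; rewrite /nfresh iotaD count_cat /region_weight0 vv; congr (_ + _)%N.
  apply: eq_in_count => t; rewrite mem_iota /= add0n ltnS => tn.
  exact: (region_freshE (zv 0%N (leq0n _))).
rewrite /walk_weight add0n (big_nth v) big_mkord -sum1_count.
rewrite -[n.+1 in LHS]addn0 iotaDl big_map -[size s in LHS]subn0.
rewrite -/(index_iota 0 (size s)) big_mkord big_mkcond /=.
apply: eq_bigr => j _; have jl := ltn_ord j.
rewrite /region_weight -(region_freshE (zv j.+1 jl)) // -fresh_shift.
by rewrite addSnnS [(n + _)%N]addnC; case: fresh.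
Qed.

Lemma sol_walk (m : nat) (z : nat -> R) : tropical_sol n (n.+1 + m) a z ->
  (forall s t, (s < n.+1 + m)%N -> (t < n.+1 + m)%N -> (s <= t + n)%N ->
     (t <= s + n)%N -> `|z s - z t| <= B%:R) ->
  exists v s, [/\ path region_step v s, size s = m
    & nfresh n (n.+1 + m) z = (region_weight0 v + walk_weight region_weight s)%N].
Proof.
move=> sol zB.
have /choice[V VP] : forall j, exists v, (j <= m)%N -> region_of v (fun i => z (j + i)%N).
  move=> j; have [jm|jm] := leqP j m; last by exists [ffun=> ord0]; lia.
  have [|v vz] := @region_exists (fun i => z (j + i)%N); last by exists v.
  by move=> s t sn tn; apply: zB; lia.
have valid j : (j <= m)%N -> region_valid (V j).
  move=> jm; apply/asboolP; exists (fun i => z (j + i)%N); split; last exact: VP.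
  move=> i ik; have -> : i = 0%N by lia.
  by have [|i1 [i2 h]] := sol j; [lia | exists i1, i2].
have step j : (j < m)%N -> region_step (V j) (V j.+1).
  move=> jm; apply/and3P; split; [exact/valid/ltnW|exact: valid|].
  apply/forallP => i; apply/forallP => i'; apply/eqP/val_inj.
  have := VP j (ltnW jm) (lift ord0 i) (lift ord0 i').
  have := VP j.+1 jm (widen_ord (leqnSn n) i) (widen_ord (leqnSn n) i').
  by rewrite !lift0 /= !addSnnS => -> h; move: h; lia.
exists (V 0%N), [seq V j | j <- iota 1 m]; split.
- suff : forall d j, (j + d <= m)%N -> path region_step (V j) [seq V i | i <- iota j.+1 d].
    by move/(_ m 0%N); rewrite add0n; apply.
  elim=> //= d IH j jd; rewrite step /=; last by lia.
  by apply: IH; lia.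
- by rewrite size_map size_iota.
- have es : size [seq V j | j <- iota 1 m] = m by rewrite size_map size_iota.
  rewrite -{1}es; apply: walk_nfresh; first exact: valid.
  move=> j; rewrite es => jm; have -> : nth (V 0%N) (V 0%N :: [seq V i | i <- iota 1 m]) j = V j.
    by rewrite -[_ :: _]/[seq V i | i <- iota 0 m.+1] (nth_map 0%N) ?size_iota // nth_iota.
  exact: VP.
Qed.

End Regions.

Theorem hilbert_quasilinear (R : realType) (n A : nat) (a : n.+1.-tuple int) :
  (0 < n)%N -> (forall i, (`|tnth a i| <= A)%N) ->
  exists c, forall k, (hilbert_preperiod A n <= k)%N ->
    tropical_hilbert R a (k + hilbert_period A n) = (tropical_hilbert R a k + c)%N.
Proof.
move=> n0 aA.
have cA i : (i <= n)%N -> (`|coef a i| <= A)%N.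
  by move=> ilen; have := aA (Ordinal (ilen : (i < n.+1)%N)); rewrite (tnth_nth 0).
have [||||c cP] := @max_walk_quasilinear (region n A) (region_step R (coef a))
  (@region_weight n A) (@region_weight0 R n A (coef a)) n.+1
  (fun m => tropical_hilbert R a (n.+1 + m)).
- by move=> v; apply: leq_b1.
- move=> v; rewrite /region_weight0; case: ifP => // _.
  by apply: leq_trans (count_size _ _) _; rewrite size_iota.
- move=> v s vs; have [vv|nv] := boolP (region_valid R (coef a) v).
    have [z [sol zv]] := walk_realized n0 vv vs.
    by rewrite -(walk_nfresh n0 vv zv); apply: nfresh_le_hilbert.
  case: s vs => [|w s] /=; last by rewrite /region_step (negPf nv).
  by rewrite /region_weight0 (negPf nv) /walk_weight big_nil.
- move=> m; have [y [sol ->]] := hilbert_attained R a (n.+1 + m) n0.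
  have [z [sol' <- zB]] := bounded_sol cA sol.
  exact: sol_walk sol' zB.
rewrite card_region in cP; exists c => k; rewrite /hilbert_preperiod => kM.
have nk : (n.+1 <= k)%N by lia.
by have := cP (k - n.+1)%N; rewrite addnA subnKC //; apply; lia.
Qed.

(** * Integral solutions *)

Lemma tropical_solbP (n k : nat) (al y : nat -> nat) :
  reflect (forall j, (j + n < k)%N -> exists i1 i2,
      [/\ (i1 <= n)%N, (i2 <= n)%N, i1 != i2 & forall i, (i <= n)%N ->
          (y (j + i1) + al i1 <= y (j + i) + al i)%N
          /\ (y (j + i2) + al i2 <= y (j + i) + al i)%N])
    (tropical_solb n k al y).
Proof.
have mem i : (i \in iota 0 n.+1) = (i <= n)%N by rewrite mem_iota add0n ltnS.
apply: (iffP allP) => h j; last rewrite mem_iota add0n.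
  rewrite window_lt => jk; have := h j; rewrite mem_iota add0n jk => /(_ isT).
  move=> /hasP[i1 h1 /hasP[i2 h2 /andP[h12 /allP hi]]].
  exists i1, i2; split; rewrite -?mem // => i; rewrite -mem => ilen.
  by have /andP := hi i ilen.
rewrite -window_lt => /h[i1 [i2 [h1 h2 h12 hi]]].
apply/hasP; exists i1; first by rewrite mem.
apply/hasP; exists i2; first by rewrite mem.
by rewrite h12; apply/allP => i; rewrite mem => /hi/andP.
Qed.

Lemma count_iota_le (P Q : pred nat) (k : nat) :
  (forall t, (t < k)%N -> P t -> Q t) ->
  (count P (iota 0 k) <= count Q (iota 0 k))%N.
Proof.
move=> PQ; rewrite (@eq_in_count _ P (predI P (fun t => t < k)%N)).
  by apply: sub_count => t /andP[pt tk]; apply: PQ.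
by move=> t; rewrite mem_iota /= => ->; rewrite andbT.
Qed.

Lemma digits_exist (Y k : nat) (y : nat -> nat) :
  (forall t, (t < k)%N -> (y t < Y)%N) ->
  exists2 x, (x < Y ^ k)%N & forall t, (t < k)%N -> digit Y x t = y t.
Proof.
elim: k => [|k IH] yY; first by exists 0%N.
have [|x xk xy] := IH; first by move=> t tk; apply: yY; apply: ltnW.
have Y0 : (0 < Y)%N by apply: leq_ltn_trans (yY 0%N _).
have ykY := yY k (ltnSn k).
exists (x + y k * Y ^ k)%N.
  rewrite expnS; apply: leq_trans (_ : (Y ^ k + y k * Y ^ k <= _)%N).
    by rewrite ltn_add2r.
  by rewrite -mulSn leq_mul2r ykY orbT.
move=> t; rewrite ltnS leq_eqVlt /digit => /predU1P[->|tk].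
  by rewrite divnDMl ?expn_gt0 ?Y0 // divn_small // add0n modn_small.
rewrite -(xy t tk) /digit; have -> : (Y ^ k = Y ^ (k - t.+1) * Y * Y ^ t)%N.
  by rewrite -mulnA -expnS -expnD subnK.
by rewrite mulnA divnDMl ?expn_gt0 ?Y0 // mulnA addnC modnMDl.
Qed.

Section Discretize.
Variables (R : realType) (n : nat) (a : n.+1.-tuple int) (k : nat).
Hypothesis k_gt0 : (0 < k)%N.

Local Notation al := (fun i => (k * shifted_coef (vector_code a) i)%N).

Lemma shifted_coef_nth (i : nat) : (i <= n)%N ->
  (shifted_coef (vector_code a) i : int) = coef a i + vector_code a.
Proof.
move=> ilen; have := shifted_coefE a (Ordinal (ilen : (i < n.+1)%N)).
by rewrite (tnth_nth 0).
Qed.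

(** The shift making the coefficients nonnegative is common to both sides and cancels. *)
Lemma rescale_le (y : nat -> nat) (s t i i' : nat) : (i <= n)%N -> (i' <= n)%N ->
  ((y s)%:R / k%:R + (coef a i)%:~R <= (y t)%:R / k%:R + (coef a i')%:~R :> R) =
  (y s + al i <= y t + al i')%N.
Proof.
move=> ilen ilen'; have k0 : (0 : R) < k%:R by rewrite ltr0n.
rewrite -(ler_nat R) !natrD !natrM.
have E l : (l <= n)%N -> ((shifted_coef (vector_code a) l)%:R : R) =
    (coef a l)%:~R + (vector_code a)%:R.
  by move=> ln; rewrite -[LHS]/((shifted_coef (vector_code a) l : int)%:~R)
    shifted_coef_nth // intrD.
have D (x : R) : k%:R * (x / k%:R) = x by rewrite mulrC divfK ?gt_eqF.
rewrite !E // -[in LHS](ler_pM2l k0) !mulrDr !D.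
by apply/idP/idP; lra.
Qed.

Lemma rescale_int (y : nat -> nat) (s t : nat) :
  ((y s)%:R / k%:R - (y t)%:R / k%:R : R) \is a Num.int ->
  (y s = y t %[mod k])%N.
Proof.
have k0 : (k%:R : R) != 0 by rewrite pnatr_eq0 -lt0n.
move=> /intrP[m em]; have : (y s)%:R - (y t)%:R = m%:~R * k%:R :> R.
  by rewrite -em mulrBl !divfK.
rewrite -[(y s)%:R]/((y s : int)%:~R) -[(y t)%:R]/((y t : int)%:~R) -[k%:R]/((k : int)%:~R).
rewrite -intrM -intrB => /intr_inj e; apply/eqP.
have [ts|st] := leqP (y t) (y s).
  by rewrite eqn_mod_dvd //; apply/dvdnP; exists `|m|%N; nia.
by rewrite eq_sym eqn_mod_dvd ?(ltnW st) //; apply/dvdnP; exists `|m|%N; nia.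
Qed.

Lemma discrete_le_hilbert (y : nat -> nat) : tropical_solb n k al y ->
  (fresh_residues n k y <= tropical_hilbert R a k)%N.
Proof.
move=> /tropical_solbP sol; pose z t : R := (y t)%:R / k%:R.
apply: leq_trans (_ : (nfresh n k z <= _)%N).
  apply: sub_count => t /allP ft; apply/freshP => s st tn.
  have := ft s; rewrite mem_iota add0n tn /= => /(_ st).
  by apply: contra => /rescale_int/eqP.
apply: nfresh_le_hilbert => j jk; have [i1 [i2 [h1 h2 h12 h]]] := sol j jk.
by exists i1, i2; split => // i ilen; rewrite /z !rescale_le //; apply: h.
Qed.

Let c := vector_code a.
Let B := spread c n.
Variable z : nat -> R.
Hypothesis n_gt0 : (0 < n)%N.
Hypothesis sol : tropical_sol n k (coef a) z.
Hypothesis zB : forall s t, (s < k)%N -> (t < k)%N -> (s <= t + n)%N ->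
  (t <= s + n)%N -> `|z s - z t| <= B%:R.

Let fr t := z t - (Num.floor (z t))%:~R.
Let rank t := count (fun u => fr u < fr t) (iota 0 k).
Let height t := Num.floor (z t) - Num.floor (z 0%N) + (k * B)%N.
(** For [t < k], y / k has integral part [height t] and fractional part rank / k: only the order of
    the fractional parts is retained. *)
Let y t := (k * `|height t| + rank t)%N.

Lemma drift_bound t : (t < k)%N -> `|z t - z 0%N| <= (t * B)%:R.
Proof.
elim: t => [|t IH] tk; first by rewrite subrr normr0 mul0n.
have := IH (ltnW tk); have : `|z t.+1 - z t| <= B%:R by apply: zB; lia.
rewrite mulSn natrD !ler_norml => /andP[h1 h2] /andP[h3 h4].
by apply/andP; split; lra.
Qed.

Lemma height_bounds t : (t < k)%N -> 0 <= height t <= (2 * k * B)%N.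
Proof.
move=> tk; have := drift_bound tk; rewrite ler_norml => /andP[h1 h2].
have tkB : (t * B <= k * B)%N by rewrite leq_mul2r ltnW ?orbT.
have f0 := floor_le (z 0%N); have f1 := floorD1_gt (z 0%N).
have : Num.floor (z 0%N) - (t * B)%N%:Z <= Num.floor (z t).
  by rewrite floor_ge_int intrB -pmulrn; lra.
have : Num.floor (z t) < Num.floor (z 0%N) + 1 + (t * B)%N%:Z.
  by move: f1; rewrite floor_lt_int !intrD -pmulrn; lra.
by rewrite /height; lia.
Qed.

Lemma fr_bounds t : 0 <= fr t < 1.
Proof.
have := floor_le (z t); have := floorD1_gt (z t); rewrite intrD /fr => h1 h2.
by apply/andP; split; lra.
Qed.

Lemma rank_lt_size t : (t < k)%N -> (rank t < k)%N.
Proof.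
move=> tk; rewrite -[X in (_ < X)%N](size_iota 0 k) -(count_predC (fun u => fr u < fr t)).
rewrite -[X in (X < _)%N]addn0 ltn_add2l -has_count; apply/hasP; exists t.
  by rewrite mem_iota.
by rewrite /= ltxx.
Qed.

Lemma rank_le s t : fr s <= fr t -> (rank s <= rank t)%N.
Proof. by move=> st; apply: sub_count => u /= us; apply: lt_le_trans us st. Qed.

Lemma rank_lt s t : (s < k)%N -> fr s < fr t -> (rank s < rank t)%N.
Proof.
move=> sk st.
have : (count (predU (fun u => fr u < fr s)%R (pred1 s)) (iota 0 k) <= rank t)%N.
  apply: sub_count => u /= /orP[us|/eqP -> //]; exact: lt_trans us st.
have := count_predUI (fun u => fr u < fr s) (pred1 s) (iota 0 k).
rewrite (@eq_count _ (predI _ _) pred0) => [|u /=]; last first.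
  by apply/negP => /andP[us /eqP us']; rewrite us' ltxx in us.
rewrite count_pred0 addn0 count_uniq_mem ?iota_uniq // mem_iota sk /= => ->.
by rewrite addn1.
Qed.

Lemma discretized_lt t : (t < k)%N -> (y t < digit_bound c n k)%N.
Proof.
move=> tk; have := height_bounds tk; have := rank_lt_size tk.
rewrite /digit_bound -/B /y => rk hb.
have : (`|height t| <= 2 * k * B)%N by lia.
move=> /(leq_mul (leqnn k)); rewrite mulnDr; lia.
Qed.

(** The comparison is lexicographic in integral part plus coefficient, then fractional part; a
    strict inequality in the first is worth at least [k], more than any rank. *)
Lemma discretized_le s t i i' : (s < k)%N -> (t < k)%N -> (i <= n)%N ->
  (i' <= n)%N -> z s + (coef a i)%:~R <= z t + (coef a i')%:~R ->
  (y s + al i <= y t + al i')%N.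
Proof.
move=> sk tk ilen ilen' st.
have := fr_bounds s; have := fr_bounds t; rewrite /fr => /andP[t0 t1] /andP[s0 s1].
have fl : Num.floor (z s) + coef a i <= Num.floor (z t) + coef a i'.
  rewrite -ltzD1 -(ltr_int R) !intrD; lra.
have := height_bounds sk; have := height_bounds tk; have := rank_lt_size sk.
have ei := shifted_coef_nth ilen; have ei' := shifted_coef_nth ilen'.
rewrite /y => rk ht hs.
have [lt_h|] := ltnP (`|height s| + shifted_coef (vector_code a) i)
   (`|height t| + shifted_coef (vector_code a) i').
  have := leq_mul (leqnn k) lt_h; rewrite mulnS !mulnDr; lia.
have hst : height s - height t = Num.floor (z s) - Num.floor (z t).
  by rewrite /height; lia.
move=> ge_h; have eq_fl : Num.floor (z s) + coef a i = Num.floor (z t) + coef a i'.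
  by lia.
have eq_h : (`|height s| + shifted_coef (vector_code a) i =
   `|height t| + shifted_coef (vector_code a) i')%N by lia.
have : (rank s <= rank t)%N.
  apply: rank_le; rewrite /fr; have : (Num.floor (z s) + coef a i)%:~R =
    (Num.floor (z t) + coef a i')%:~R :> R by rewrite eq_fl.
  by rewrite !intrD; lra.
have := congr1 (muln k) eq_h; rewrite !mulnDr; lia.
Qed.

Lemma discretized_mod s t : (s < k)%N -> (t < k)%N ->
  (y s = y t %[mod k])%N -> z s - z t \is a Num.int.
Proof.
move=> sk tk; rewrite /y ![(k * _)%N]mulnC !modnMDl !modn_small ?rank_lt_size // => rst.
have frst : fr s = fr t.
  apply/le_anti/andP; split; rewrite leNgt; apply/negP => /rank_lt.
    by rewrite rst ltnn => /(_ tk).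
  by rewrite rst ltnn => /(_ sk).
have -> : z s - z t = (Num.floor (z s) - Num.floor (z t))%:~R.
  by move: frst; rewrite /fr intrB; lra.
exact: intr_int.
Qed.

Lemma nfresh_le_search : (nfresh n k z <= hilbert_search c n k)%N.
Proof.
have [x xY xy] := digits_exist discretized_lt.
apply: leq_trans (_ : (tropical_solb n k al (digit (digit_bound c n k) x)
     * fresh_residues n k (digit (digit_bound c n k) x) <= _)%N); last first.
  rewrite /hilbert_search; apply: (leq_bigmax_seq (F := fun x =>
    (tropical_solb n k al (digit (digit_bound c n k) x)
     * fresh_residues n k (digit (digit_bound c n k) x))%N)) => //.
  by rewrite mem_index_iota.
have -> : tropical_solb n k al (digit (digit_bound c n k) x).
  apply/tropical_solbP => j jk; have [i1 [i2 [h1 h2 h12 h]]] := sol jk.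
  exists i1, i2; split => // i ilen; have [l1 l2] := h i ilen.
  by rewrite !xy; [split; apply: discretized_le => //; lia | lia..].
rewrite mul1n; apply: count_iota_le => t tk /freshP ft.
apply/allP => s; rewrite mem_iota add0n /= => st; apply/negP => /andP[tn /eqP].
have sk := ltn_trans st tk; rewrite !xy // => /(discretized_mod tk sk).
by apply/negP/ft.
Qed.

End Discretize.

Theorem hilbert_searchE (R : realType) (n k : nat) (a : n.+1.-tuple int) :
  (0 < n)%N -> (0 < k)%N ->
  hilbert_search (vector_code a) n k = tropical_hilbert R a k.
Proof.
move=> n0 k0; apply/eqP; rewrite eqn_leq; apply/andP; split.
  apply/bigmax_leqP_seq => x _ _.
  set b := tropical_solb _ _ _ _; case: (boolP b) => [sol|_]; last by rewrite mul0n.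
  by rewrite mul1n; apply: discrete_le_hilbert.
have aA i : (i <= n)%N -> (`|coef a i| <= vector_code a)%N.
  move=> ilen; have := vector_code_ge a (Ordinal (ilen : (i < n.+1)%N)).
  by rewrite (tnth_nth 0).
have [y [sol ->]] := hilbert_attained R a k n0.
have [z [sol' <- zB]] := bounded_sol aA sol.
exact: nfresh_le_search.
Qed.

(** * Quasi-linearity *)

Lemma quasilinear_iter (d : nat -> nat) (M P c : nat) :
  (forall k, (M <= k)%N -> d (k + P)%N = (d k + c)%N) ->
  forall k q, (M <= k)%N -> d (k + q * P)%N = (d k + q * c)%N.
Proof.
move=> dP k q Mk; elim: q => [|q IH]; first by rewrite !addn0.
by rewrite mulSnr addnA dP ?IH ?mulSnr ?addnA //; apply: leq_trans Mk (leq_addr _ _).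
Qed.

Lemma periodic_bounded (R : realType) (r : nat -> R) (P : nat) : (0 < P)%N ->
  (forall k, r (k + P)%N = r k) -> exists K : R, forall k, `|r k| <= K.
Proof.
move=> P0 rP; exists (\sum_(i < P) `|r i|) => k.
have -> : r k = r (k %% P)%N.
  rewrite {1}(divn_eq k P); elim: (k %/ P)%N => [|q IH]; first by [].
  by rewrite mulSnr addnAC rP.
by rewrite (bigD1 (Ordinal (ltn_pmod k P0))) //= lerDl sumr_ge0.
Qed.

Lemma quasilinear_slope (R : realType) (d : nat -> nat) (M P c : nat) :
  (0 < P)%N -> (forall k, (M <= k)%N -> d (k + P)%N = (d k + c)%N) ->
  exists r : nat -> R, [/\ forall k, r (k + P)%N = r k,
    forall k, (M <= k)%N -> (d k)%:R = c%:R / P%:R * k%:R + r k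
    & lim ((fun k : nat => (d k)%:R / k%:R : R) @ \oo) = c%:R / P%:R].
Proof.
move=> P0 dP; have PR : (P%:R : R) != 0 by rewrite pnatr_eq0 -lt0n.
pose l : R := c%:R / P%:R; have lP : l * P%:R = c%:R by rewrite divfK.
(* Shifting by a multiple of the period that is at least [M] makes [r] periodic from 0 on. *)
pose r k : R := (d (k + M * P)%N)%:R - l * (k + M * P)%:R.
have rP k : r (k + P)%N = r k.
  rewrite /r addnAC dP; last by apply: leq_trans (leq_pmulr _ P0) (leq_addl _ _).
  by rewrite natrD [(_ + P)%:R]natrD mulrDr lP; lra.
have dE k : (M <= k)%N -> (d k)%:R = l * k%:R + r k.
  move=> Mk; rewrite /r (quasilinear_iter dP) // !natrD !natrM -lP; lra.
exists r; split => //; apply: cvg_lim => //.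
have [K rK] := periodic_bounded P0 rP.
apply/cvgrPdist_le => e e0; exists (maxn M (Num.truncn (K / e)).+1) => // k /=.
rewrite geq_max => /andP[Mk Kk]; have k0 : (0 < k)%N by apply: leq_trans Kk.
have kR : (0 : R) < k%:R by rewrite ltr0n.
rewrite dE // mulrDl mulfK ?gt_eqF // opprD addNKr normrN normrM normfV.
rewrite (gtr0_norm kR) ler_pdivrMr //; apply: le_trans (rK k) _.
rewrite mulrC -ler_pdivrMr //; apply: ltW; apply: lt_le_trans (truncnS_gt _) _.
by rewrite ler_nat.
Qed.

Lemma hilbert_program_output (n : nat) (a : n.+1.-tuple int) (c := vector_code a)
    (M := hilbert_preperiod c n) (P := hilbert_period c n) :
  hilbert_program c = ql_code (QuasiLinear P
    (hilbert_search c n (M + P) - hilbert_search c n M)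
    (mkseq (hilbert_search c n) (M + P))).
Proof.
rewrite /hilbert_program {1 2 3}/c code_sizeE size_map size_tuple /= -/M -/P.
by rewrite /hilbert_output hilbert_table_codeE /ql_code !code_cons !mul2n.
Qed.

(** The table is filled with [f], which agrees with [d] at positive arguments; [0 < M] keeps the
    entry at 0 out of the part that is repeated. *)
Lemma ql_eval_table (d f : nat -> nat) (M P c k : nat) : (0 < M)%N -> (0 < P)%N ->
  (forall j, (M <= j)%N -> d (j + P)%N = (d j + c)%N) ->
  (forall j, (0 < j)%N -> f j = d j) -> (0 < k)%N ->
  ql_eval (QuasiLinear P (f (M + P)%N - f M) (mkseq f (M + P))) k = d k.
Proof.
move=> M0 P0 dP fd k0; rewrite /ql_eval /= size_mkseq addnK.
have [kM|Mk] := ltnP k M; first by rewrite nth_mkseq ?fd // ltn_addr.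
have rP := ltn_pmod (k - M) P0; rewrite nth_mkseq ?ltn_add2l //.
rewrite !fd ?addn_gt0 ?M0 // dP // addKn mulnC -(quasilinear_iter dP) ?leq_addr //.
by rewrite -addnA [(_ %% _ + _)%N]addnC -divn_eq subnKC.
Qed.

Theorem theorem0p3 (R : realType) :
  (forall (n : nat) (a : n.+1.-tuple int), (1 <= n)%N ->
     exists (r : nat -> R) (p k0 : nat),
       [/\ (0 < p)%N,
           forall k : nat, (0 < k)%N -> r (k + p)%N = r k
         & forall k : nat, (0 < k)%N -> (k0 <= k)%N ->
             (tropical_hilbert R a k)%:R = tropical_entropy R a * k%:R + r k])
  /\ (exists e : recfun, computes_tropical_hilbert R e).
Proof.
split=> [n a n1|].
  have [c cP] := hilbert_quasilinear R n1 (vector_code_ge a).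
  have [r [rP rE lE]] := quasilinear_slope R (fact_gt0 _) cP.
  exists r, (hilbert_period (vector_code a) n), (hilbert_preperiod (vector_code a) n).
  split=> [|k _|k _ kM]; [exact: fact_gt0|exact: rP|].
  by rewrite /tropical_entropy lE rE.
have [e eP] := computable_hilbert_program; exists e => n a n1.
have [c cP] := hilbert_quasilinear R n1 (vector_code_ge a).
have P0 : (0 < hilbert_period (vector_code a) n)%N := fact_gt0 _.
have M0 : (0 < hilbert_preperiod (vector_code a) n)%N by [].
(* The description is determined by unification with the table in the first goal treated. *)
eexists; split; last first.
- by move=> k k0; apply/esym/(ql_eval_table M0 P0 cP _ k0) => j; apply: hilbert_searchE.
- by rewrite -hilbert_program_output; apply: (eP [:: _]).
- by rewrite /ql_wf /ql_table /ql_period size_mkseq P0 leq_addl.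
Qed.
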